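(* Consider the optimal promotion $\mathbf{s}^{\rm opt}=(s_p^{\rm opt},s_q^{\rm opt})$ in the Bass model on the homogeneous complete network as $M\to\infty$, with $p(s_p)=p_0+b_p\sqrt{s_p}$ and $q(s_q)=q_0+b_q\sqrt{s_q}$. Assume that $q_0>\theta$. Then $$s_p^{\rm opt}(0)>0,\qquad \frac{d}{dt}s_p^{\rm opt}(0)<0.$$
   Context: In the limit $M\to\infty$, under a promotion $\mathbf{s}=(s_p,s_q)$ of piecewise-continuous functions $[0,T]\to[0,\infty)$, the expected adoption level $f$ solves $\frac{df}{dt}=(1-f)\big(p(s_p(t))+q(s_q(t))f\big)$, $f(0)=0$, and the optimal promotion maximizes $\Pi[\mathbf{s}]=\int_0^Te^{-\theta t}\big(\gamma\frac{df}{dt}-s_p(t)-s_q(t)\big)dt$. The optimal promotion is given by $$s_p^{\rm opt}(t)=\frac{b_p^2}{4}\big((1-f)(\Psi e^{\theta t}+\gamma)\big)^2,\qquad s_q^{\rm opt}(t)=\frac{b_q^2}{b_p^2}f^2s_p^{\rm opt}(t),$$ where $f,\Psi$ solve, with $s_p=s_p^{\rm opt}$, $s_q=s_q^{\rm opt}$, the boundary-value problem $\frac{df}{dt}=(1-f)\big(p(s_p)+q(s_q)f\big)$, $f(0)=0$; $\frac{d\Psi}{dt}=(\gamma e^{-\theta t}+\Psi)\big(p(s_p)+q(s_q)(2f-1)\big)$, $\Psi(T)=0$. Here $p_0,q_0,b_p,b_q,\gamma>0$ are constants, $\theta\ge0$ is the discount rate (positive if $T=\infty$), and $T\in(0,\infty]$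 is the planning horizon (if $T=\infty$, the terminal condition is understood as $t\to\infty$). *)

(* Defs.v *)
From Stdlib Require Import Reals.
From Coquelicot Require Import Coquelicot.

Set Implicit Arguments.
Unset Strict Implicit.

Open Scope R_scope.

(* The planning horizon T ranges over (0, +oo]; all functions of time are total
   on R, and only their values on [0, T] (on [0, +oo) if T = p_infty) matter. *)
Definition in_horizon (T : Rbar) (t : R) : Prop := 0 <= t /\ Rbar_le t T.

Definition horizon_end (T : Rbar) : (R -> Prop) -> Prop :=
  match T with
  | Finite x => at_point x
  | _ => Rbar_locally T
  end.

(* Piecewise continuous, with finitely many pieces on each bounded interval.
   The value at a jump is taken to be the right limit.  A convention is needed
   because the profit below ignores finitely many values of a promotion, so
   without one the value at time 0 would be meaningless. *)
Definition piecewise_continuous (T : Rbar) (s : R -> R) : Prop :=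
  forall X : R, 0 < X -> Rbar_le X T ->
  exists (n : nat) (x : nat -> R),
    x 0%nat = 0 /\ x n = X /\
    forall i : nat, (i < n)%nat ->
      x i < x (S i) /\
      (forall t : R, x i < t < x (S i) -> continuous s t) /\
      filterlim s (at_right (x i)) (locally (s (x i))) /\
      (exists l : R, filterlim s (at_left (x (S i))) (locally l)).

Definition promotion (T : Rbar) (s : R -> R) : Prop :=
  piecewise_continuous T s /\ (forall t : R, in_horizon T t -> 0 <= s t).

(* f is the expected adoption level, in the limit of infinitely many consumers,
   under the promotion (sp, sq).  As the right-hand side may jump, f is
   continuous and the equation is imposed where sp and sq are continuous. *)
Definition adoption_level (p q : R -> R) (T : Rbar) (sp sq f : R -> R) : Prop :=
  continuous_on (in_horizon T) f /\
  f 0 = 0 /\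
  (forall t : R, 0 < t -> Rbar_lt t T -> continuous sp t -> continuous sq t ->
     is_derive f t ((1 - f t) * (p (sp t) + q (sq t) * f t))).

(* v is the profit int_0^T e^(-theta t) (gamma f'(t) - sp(t) - sq(t)) dt, an
   improper integral when T = p_infty.  [Derive f] is a junk value at the
   isolated jumps of the promotion, which the integral does not see. *)
Definition is_profit (gamma theta : R) (T : Rbar) (sp sq f : R -> R) (v : R)
  : Prop :=
  is_RInt_gen
    (fun t : R => exp (- theta * t) * (gamma * Derive f t - sp t - sq t))
    (at_point 0) (horizon_end T) v.

(* The maximum is over all promotions with a convergent profit integral.  When
   T = p_infty and 0 < theta, every other promotion has profit -oo. *)
Definition optimal_promotion (p q : R -> R) (gamma theta : R) (T : Rbar)
    (sp sq : R -> R) : Prop :=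
  promotion T sp /\ promotion T sq /\
  exists (f : R -> R) (v : R),
    adoption_level p q T sp sq f /\
    is_profit gamma theta T sp sq f v /\
    (forall (sp' sq' f' : R -> R) (v' : R),
       promotion T sp' -> promotion T sq' ->
       adoption_level p q T sp' sq' f' ->
       is_profit gamma theta T sp' sq' f' v' -> v' <= v).

Definition is_right_derive (s : R -> R) (t l : R) : Prop :=
  filterlim (fun u : R => (s u - s t) / (u - t)) (at_right t) (locally l).

(* Main.v *)
(* The adoption equation f' = (1-f)(p + q f) becomes linear in g = 1/(1-f),
   namely g' = (p+q) g - q.  With E(t) = exp(int_0^t q(1-f)), raising p by
   E y' / (1 + E y) and keeping q replaces f by 1 - (1-f)/(1 + E y), so every
   perturbation of s_p with y' supported in a short interval [0,c] on which s_p
   and s_q are continuous has an explicit adoption level, and an explicit profit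
   after integrating the revenue by parts.

   If s_p(0) = 0, taking y' = k constant on [0,c] gains revenue of order k c at a
   cost of order (k + sup_[0,c] sqrt s_p) k c, so a small kick improves the profit.

   Hence s_p > 0 near 0, and y' of both signs is allowed.  With y(c) = 0 only
   [0,c] is affected, and the first variation is int (alpha y - beta y') with
     alpha = gamma theta e^(-theta t) (1-f) E,  beta = 2 e^(-theta t) sqrt(s_p) E / b_p.
   Taking y' proportional to the deviation of beta + int_0^t alpha from its mean
   shows that this function is constant, which makes s_p right differentiable,
   with u = sqrt(s_p) satisfying
     u'(0) = u(0) (theta - q(s_q(0))) - gamma theta b_p / 2 < 0. *)

Require Import Defs.
From Stdlib Require Import Reals Lra Lia.
From Coquelicot Require Import Coquelicot.

Open Scope R_scope.

(** * Piecewise continuous functions *)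

Definition piece (s : R -> R) (a b : R) : Prop :=
  a < b /\
  (forall t : R, a < t < b -> continuous s t) /\
  filterlim s (at_right a) (locally (s a)) /\
  (exists l : R, filterlim s (at_left b) (locally l)).

(** The right end is a parameter and the left end an index, so that induction removes the leftmost
    piece. *)
Inductive pieces (s : R -> R) (b : R) : R -> Prop :=
| pieces_last a : piece s a b -> pieces s b a
| pieces_cons a m : piece s a m -> pieces s b m -> pieces s b a.

Lemma pieces_of_partition s n (x : nat -> R) :
  (forall i : nat, (i < S n)%nat -> piece s (x i) (x (S i))) ->
  pieces s (x (S n)) (x 0%nat).
Proof.
revert x; induction n as [|n IHn]; intros x Hx.
  apply pieces_last, Hx; lia.
apply pieces_cons with (x 1%nat); [apply Hx; lia|].
apply (IHn (fun i => x (S i))); intros i Hi; apply Hx; lia.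
Qed.

Lemma partition_of_pieces s a b : pieces s b a ->
  exists (n : nat) (x : nat -> R), x 0%nat = a /\ x n = b /\
    forall i : nat, (i < n)%nat -> piece s (x i) (x (S i)).
Proof.
induction 1 as [a Hab|a m Ham _ [n [x [Hx0 [Hxn Hx]]]]].
  exists 1%nat, (fun i => match i with O => a | _ => b end).
  split; [reflexivity|split; [reflexivity|]].
  intros i Hi; replace i with 0%nat by lia; exact Hab.
exists (S n), (fun i => match i with O => a | S j => x j end).
split; [reflexivity|split; [exact Hxn|]].
intros [|i] Hi; [rewrite Hx0; exact Ham|apply Hx; lia].
Qed.

Lemma pieces_lt s a b : pieces s b a -> a < b.
Proof.
induction 1 as [a Hab|a m Ham _ IH]; [apply Hab|].
apply Rlt_trans with m; [apply Ham|exact IH].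
Qed.

Lemma piece_split s a m b : a < m < b -> piece s a b ->
  piece s a m /\ piece s m b.
Proof.
intros Hm [Hab [Hc [Ha Hb]]].
assert (Hcm : continuous s m) by (apply Hc; lra).
split; split; try lra; split.
- intros t Ht; apply Hc; lra.
- split; [exact Ha|]. exists (s m).
  intros P HP; apply filter_le_within, Hcm, HP.
- intros t Ht; apply Hc; lra.
- split; [|exact Hb].
  intros P HP; apply filter_le_within, Hcm, HP.
Qed.

Lemma pieces_split s a m b : a < m < b -> pieces s b a ->
  pieces s m a /\ pieces s b m.
Proof.
intros [Ham Hmb] H; revert m Ham Hmb.
induction H as [a Hab|a k Hak Hkb IH]; intros m Ham Hmb.
  destruct (piece_split s a m b) as [H1 H2]; [lra|exact Hab|].
  split; apply pieces_last; assumption.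
destruct (Rtotal_order m k) as [Hmk|[->|Hkm]].
- destruct (piece_split s a m k) as [H1 H2]; [lra|exact Hak|].
  split; [apply pieces_last|apply pieces_cons with k]; assumption.
- split; [apply pieces_last|]; assumption.
- destruct (IH m Hkm Hmb) as [H1 H2].
  split; [apply pieces_cons with k|]; assumption.
Qed.

Lemma piece_ext s1 s2 a b : (forall t, a <= t < b -> s1 t = s2 t) ->
  piece s1 a b -> piece s2 a b.
Proof.
intros Heq [Hab [Hc [Ha [l Hl]]]].
split; [exact Hab|split; [|split]].
- intros t Ht; apply (continuous_ext_loc s2 s1); [|apply Hc, Ht].
  apply (open_and (fun t => a < t) (fun t => t < b)) in Ht;
    [|apply open_gt|apply open_lt].
  revert Ht; apply filter_imp; intros y Hy; apply Heq; lra.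
- rewrite <- (Heq a) by lra.
  apply filterlim_ext_loc with s1; [|exact Ha].
  exists (mkposreal (b - a) ltac:(lra)); intros y Hy Hay; apply Heq.
  unfold ball in Hy; simpl in Hy; unfold AbsRing_ball, abs, minus, plus, opp in Hy.
  simpl in Hy; apply Rabs_def2 in Hy; lra.
- exists l; apply filterlim_ext_loc with s1; [|exact Hl].
  exists (mkposreal (b - a) ltac:(lra)); intros y Hy Hay; apply Heq.
  unfold ball in Hy; simpl in Hy; unfold AbsRing_ball, abs, minus, plus, opp in Hy.
  simpl in Hy; apply Rabs_def2 in Hy; lra.
Qed.

Lemma pieces_ext s1 s2 a b : (forall t, a <= t < b -> s1 t = s2 t) ->
  pieces s1 b a -> pieces s2 b a.
Proof.
intros Heq H; induction H as [a Hab|a m Ham Hmb IH].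
  apply pieces_last; revert Hab; apply piece_ext; exact Heq.
apply pieces_cons with m.
  revert Ham; apply piece_ext; intros t Ht; apply Heq.
  apply pieces_lt in Hmb; lra.
apply IH; intros t Ht; apply Heq; destruct Ham as [Ham _]; lra.
Qed.

Lemma piecewise_continuous_pieces T s : piecewise_continuous T s <->
  (forall X : R, 0 < X -> Rbar_le X T -> pieces s X 0).
Proof.
split; intros H X HX HXT.
  destruct (H X HX HXT) as [[|n] [x [Hx0 [Hxn Hx]]]]; [lra|].
  rewrite <- Hx0, <- Hxn; apply pieces_of_partition; exact Hx.
destruct (partition_of_pieces s 0 X (H X HX HXT)) as [n [x Hx]].
exists n, x; exact Hx.
Qed.

(** Agreement is required on the open interval only, because [s] may jump at both ends; the globally
    continuous [g] can then serve as a coefficient up to the ends. *)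
Definition extends_continuously (s : R -> R) (a b : R) : Prop :=
  exists g : R -> R, (forall t, continuous g t) /\
    forall t, a < t < b -> s t = g t.

(** The one-sided limits provide the end values of [g]. Since the value at a jump is the right
    limit, [g] also agrees with [s] at [a]. *)
Lemma piece_extension s a b : piece s a b ->
  exists g : R -> R, (forall t, continuous g t) /\
    forall t, a <= t < b -> s t = g t.
Proof.
intros [Hab [Hc [Ha [l Hl]]]].
destruct (C0_extension_lt s (s a) l a b Hab Hc Ha Hl) as [g [Hg [Hgs [Hga _]]]].
exists g; split; [exact Hg|].
intros t [[Hat|<-] Htb]; [symmetry; apply Hgs; lra|now rewrite Hga].
Qed.

(* Both functions may be assumed continuous, which amounts to passing to a
   common refinement of the two partitions. *)
Lemma joint_pieces_ind s1 s2 (Q : R -> R -> Prop) A B :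
  pieces s1 B A -> pieces s2 B A ->
  (forall a m b, A <= a -> a < m < b -> b <= B -> Q a m -> Q m b -> Q a b) ->
  (forall a b, A <= a -> a < b -> b <= B ->
     extends_continuously s1 a b -> extends_continuously s2 a b -> Q a b) ->
  Q A B.
Proof.
intros H1 H2 Hadd Hbase.
assert (Hpc : forall s a b c d, piece s a b -> a <= c -> d <= b ->
    extends_continuously s c d).
  intros s a b c d Hab Hac Hdb.
  destruct (piece_extension s a b Hab) as [g [Hg Hgs]].
  exists g; split; [exact Hg|intros t Ht; apply Hgs; lra].
(* Inner induction, over the pieces of [s2] inside a single piece of [s1]; the outer induction
   [Hout] runs over the pieces of [s1]. *)
assert (Hin : forall a b, A <= a -> b <= B -> piece s1 a b -> pieces s2 b a ->
    Q a b).
  intros a b Ha Hb Hab H; revert Ha Hab.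
  induction H as [a Hab'|a m Ham Hmb IH]; intros Ha Hab.
    apply Hbase; [exact Ha|apply Hab|exact Hb|apply (Hpc s1 a b)|apply (Hpc s2 a b)];
      auto; lra.
  assert (Hm : a < m < b) by (split; [apply Ham|apply (pieces_lt s2), Hmb]).
  destruct (piece_split s1 a m b Hm Hab) as [Hl Hr].
  apply Hadd with m; [exact Ha|exact Hm|exact Hb| |].
    apply Hbase; try lra; [apply (Hpc s1 a m)|apply (Hpc s2 a m)]; auto; lra.
  apply IH; [lra|exact Hr].
enough (Hout : forall a, pieces s1 B a -> A <= a -> pieces s2 B a -> Q a B).
  apply Hout; auto; lra.
clear H1 H2; intros a H1; induction H1 as [a Hab|a m Ham Hmb IH]; intros Ha H2.
  apply Hin; auto; lra.
assert (Hm : a < m < B) by (split; [apply Ham|apply (pieces_lt s1), Hmb]).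
destruct (pieces_split s2 a m B Hm H2) as [Hl Hr].
apply Hadd with m; [exact Ha|exact Hm|lra| |].
  apply Hin; auto; lra.
apply IH; [lra|exact Hr].
Qed.

(** * Monotonicity and integration on open intervals *)

Lemma continuous_clamp (a b t : R) :
  continuous (fun x : R => Rmax a (Rmin b x)) t.
Proof.
apply continuity_pt_filterlim; unfold Rmax, Rmin.
intros eps Heps; exists eps; split; [lra|].
intros y [_ Hy]; simpl in *; unfold Rdist in *.
apply Rabs_def2 in Hy; apply Rabs_def1;
repeat destruct Rle_dec; lra.
Qed.

Lemma clamp_id a b t : a <= t <= b -> Rmax a (Rmin b t) = t.
Proof. intros Ht; rewrite Rmin_right, Rmax_right; lra. Qed.

Lemma clamp_in a b t : a <= b -> a <= Rmax a (Rmin b t) <= b.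
Proof. unfold Rmax, Rmin; repeat destruct Rle_dec; lra. Qed.

Lemma derive_nonneg_open_le (F phi : R -> R) a b : a < b ->
  (forall t, a <= t <= b -> continuous F t) ->
  (forall t, a < t < b -> is_derive F t (phi t)) ->
  (forall t, a < t < b -> 0 <= phi t) -> F a <= F b.
Proof.
intros Hab HF Hd Hp.
(* The mean value point may be an end point, where the sign of [phi] is unknown. Truncating [phi] at
   0 changes nothing inside and settles the ends. *)
destruct (MVT_gen F a b (fun t => Rmax 0 (phi t))) as [c [_ Hc]];
  rewrite ?Rmin_left, ?Rmax_right by lra.
- intros t Ht; rewrite Rmax_right by (apply Hp, Ht); apply Hd, Ht.
- intros t Ht; apply continuity_pt_filterlim, HF, Ht.
- assert (0 <= Rmax 0 (phi c) * (b - a)); [|lra].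
  apply Rmult_le_pos; [apply Rmax_l|lra].
Qed.

Lemma derive_zero_open_eq (F : R -> R) a b : a < b ->
  (forall t, a <= t <= b -> continuous F t) ->
  (forall t, a < t < b -> is_derive F t 0) -> F a = F b.
Proof.
intros Hab HF Hd; apply Rle_antisym.
  apply derive_nonneg_open_le with (fun _ => 0); auto; intros; lra.
apply Ropp_le_cancel.
apply derive_nonneg_open_le with (F := fun t => - F t) (phi := fun _ => 0);
  auto; try (intros; lra).
  intros t Ht; apply (continuous_opp F), HF, Ht.
intros t Ht; rewrite <- Ropp_0; apply (is_derive_opp F), Hd, Ht.
Qed.

Lemma is_derive_RInt_continuous (f : R -> R) a t :
  (forall x, continuous f x) -> is_derive (RInt f a) t (f t).
Proof.
intros Hf; apply is_derive_RInt with a; [|apply Hf].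
apply filter_forall; intros x; apply (RInt_correct (V := R_CompleteNormedModule)).
apply (ex_RInt_continuous (V := R_CompleteNormedModule)); intros; apply Hf.
Qed.

Lemma ex_RInt_continuous_everywhere (f : R -> R) a b :
  (forall x, continuous f x) -> ex_RInt f a b.
Proof. intros Hf; apply (ex_RInt_continuous (V := R_CompleteNormedModule)); intros; apply Hf. Qed.

(** As [F] need not be differentiable at the ends, it is compared with the primitive of the clamped
    [phi]: their difference is continuous up to the ends and has derivative 0 inside. *)
Lemma FTC_open (F phi : R -> R) a b : a < b ->
  (forall t, a <= t <= b -> continuous F t) ->
  (forall t, a <= t <= b -> continuous phi t) ->
  (forall t, a < t < b -> is_derive F t (phi t)) ->
  is_RInt phi a b (F b - F a).
Proof.
intros Hab HF Hp Hd.
set (psi t := phi (Rmax a (Rmin b t))).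
assert (Hpsi : forall t, continuous psi t).
  intros t; apply (continuous_comp (fun x => Rmax a (Rmin b x)) phi); [apply continuous_clamp|].
  apply Hp, clamp_in; lra.
assert (Heq : F a - RInt psi a a = F b - RInt psi a b).
  apply (derive_zero_open_eq (fun t => F t - RInt psi a t)); [exact Hab| |].
    intros t Ht; apply (continuous_minus F); [apply HF, Ht|].
    apply (ex_derive_continuous (RInt psi a)); exists (psi t).
    apply is_derive_RInt_continuous, Hpsi.
  intros t Ht; replace 0 with (minus (phi t) (psi t)).
    apply (is_derive_minus F); [apply Hd, Ht|].
    apply is_derive_RInt_continuous, Hpsi.
  unfold psi; rewrite clamp_id by lra; exact (Rminus_diag (phi t)).
rewrite RInt_point in Heq; unfold zero in Heq; simpl in Heq.
replace (F b - F a) with (RInt psi a b) by lra.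
apply is_RInt_ext with psi.
  rewrite Rmin_left, Rmax_right by lra.
  intros x Hx; unfold psi; rewrite clamp_id; [reflexivity|lra].
apply (RInt_correct (V := R_CompleteNormedModule)), ex_RInt_continuous_everywhere, Hpsi.
Qed.

(** * Rules for continuity and derivatives of real functions *)

Lemma continuous_Rplus (f g : R -> R) (x : R) :
  continuous f x -> continuous g x -> continuous (fun t => f t + g t) x.
Proof. exact (continuous_plus f g x). Qed.

Lemma continuous_Rminus (f g : R -> R) (x : R) :
  continuous f x -> continuous g x -> continuous (fun t => f t - g t) x.
Proof. exact (continuous_minus f g x). Qed.

Lemma continuous_Rmult (f g : R -> R) (x : R) :
  continuous f x -> continuous g x -> continuous (fun t => f t * g t) x.
Proof. exact (continuous_mult f g x). Qed.

Lemma continuous_Ropp (f : R -> R) (x : R) :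
  continuous f x -> continuous (fun t => - f t) x.
Proof. exact (continuous_opp f x). Qed.

Lemma continuous_Rdiv (f g : R -> R) (x : R) :
  continuous f x -> continuous g x -> g x <> 0 ->
  continuous (fun t => f t / g t) x.
Proof.
intros Hf Hg Hgx; apply continuous_Rmult; [exact Hf|].
apply (continuous_comp g Rinv); [exact Hg|].
apply continuity_pt_filterlim, continuity_pt_inv; [|exact Hgx].
apply continuity_pt_id.
Qed.

Lemma continuous_Rexp (f : R -> R) (x : R) :
  continuous f x -> continuous (fun t => exp (f t)) x.
Proof.
intros Hf; apply (continuous_comp f exp); [exact Hf|apply continuous_exp].
Qed.

Lemma continuous_Rcomp (f g : R -> R) (x : R) :
  (forall t, continuous g t) -> continuous f x -> continuous (fun t => g (f t)) x.
Proof. intros Hg Hf; apply (continuous_comp f g); [exact Hf|apply Hg]. Qed.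

Lemma is_derive_continuous (f : R -> R) (x l : R) :
  is_derive f x l -> continuous f x.
Proof. intros H; apply (ex_derive_continuous f); exists l; exact H. Qed.

Lemma locally_between (a b t : R) : a < t < b ->
  locally t (fun s => a < s < b).
Proof.
apply (open_and (fun s => a < s) (fun s => s < b)); [apply open_gt|apply open_lt].
Qed.

Ltac cont :=
  repeat match goal with
  | H : continuous ?f ?x |- continuous ?f ?x => exact H
  | |- continuous (fun _ => ?c) ?x => apply continuous_const
  | |- continuous (fun t => t) ?x => apply continuous_id
  | |- continuous (fun t => @?f t + @?g t) ?x => apply (continuous_Rplus f g x)
  | |- continuous (fun t => @?f t - @?g t) ?x => apply (continuous_Rminus f g x)
  | |- continuous (fun t => @?f t * @?g t) ?x => apply (continuous_Rmult f g x)
  | |- continuous (fun t => @?f t / @?g t) ?x => apply (continuous_Rdiv f g x)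
  | |- continuous (fun t => - @?f t) ?x => apply (continuous_Ropp f x)
  | |- continuous (fun t => exp (@?f t)) ?x => apply (continuous_Rexp f x)
  | |- continuous (fun t => sqrt (@?f t)) ?x => apply (continuous_sqrt_comp f x)
  end.

Lemma is_derive_Rplus (f g : R -> R) (x a b : R) :
  is_derive f x a -> is_derive g x b -> is_derive (fun t => f t + g t) x (a + b).
Proof. exact (is_derive_plus f g x a b). Qed.

Lemma is_derive_Rminus (f g : R -> R) (x a b : R) :
  is_derive f x a -> is_derive g x b -> is_derive (fun t => f t - g t) x (a - b).
Proof. exact (is_derive_minus f g x a b). Qed.

Lemma is_derive_Ropp (f : R -> R) (x a : R) :
  is_derive f x a -> is_derive (fun t => - f t) x (- a).
Proof. exact (is_derive_opp f x a). Qed.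

Lemma is_derive_Rmult (f g : R -> R) (x a b : R) :
  is_derive f x a -> is_derive g x b ->
  is_derive (fun t => f t * g t) x (a * g x + f x * b).
Proof. intros Hf Hg; apply (is_derive_mult f g x a b Hf Hg Rmult_comm). Qed.

Lemma is_derive_Rdiv (f g : R -> R) (x a b : R) :
  is_derive f x a -> is_derive g x b -> g x <> 0 ->
  is_derive (fun t => f t / g t) x ((a * g x - f x * b) / g x ^ 2).
Proof. intros Hf Hg Hx; exact (is_derive_div f g x a b Hf Hg Hx). Qed.

Lemma is_derive_Rexp (f : R -> R) (x a : R) :
  is_derive f x a -> is_derive (fun t => exp (f t)) x (a * exp (f x)).
Proof.
intros Hf; apply (is_derive_comp exp f x (exp (f x)) a); [|exact Hf].
apply is_derive_exp.
Qed.

Lemma is_derive_Rconst (a x : R) : is_derive (fun _ : R => a) x 0.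
Proof. exact (is_derive_const a x). Qed.

Lemma is_derive_Rid (x : R) : is_derive (fun t : R => t) x 1.
Proof. exact (is_derive_id x). Qed.

Ltac der :=
  evar_last;
  [repeat match goal with
  | H : is_derive ?f ?x _ |- is_derive ?f ?x _ => exact H
  | H : is_derive ?f ?x _ |- is_derive (fun t => ?f t) ?x _ => exact H
  | |- is_derive (fun _ => ?c) ?x _ => apply is_derive_Rconst
  | |- is_derive (fun t => t) ?x _ => apply is_derive_Rid
  | |- is_derive (fun t => @?f t + @?g t) ?x _ => apply (is_derive_Rplus f g x)
  | |- is_derive (fun t => @?f t - @?g t) ?x _ => apply (is_derive_Rminus f g x)
  | |- is_derive (fun t => @?f t * @?g t) ?x _ => apply (is_derive_Rmult f g x)
  | |- is_derive (fun t => @?f t / @?g t) ?x _ => apply (is_derive_Rdiv f g x)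
  | |- is_derive (fun t => - @?f t) ?x _ => apply (is_derive_Ropp f x)
  | |- is_derive (fun t => exp (@?f t)) ?x _ => apply (is_derive_Rexp f x)
  end |].

(** * The adoption level *)

(** The projection onto the horizon. Composing with it turns continuity on the horizon into
    continuity on all of R. *)
Definition clampT (T : Rbar) (t : R) : R :=
  match T with Finite x => Rmax 0 (Rmin x t) | _ => Rmax 0 t end.

Lemma clampT_id T t : in_horizon T t -> clampT T t = t.
Proof.
destruct T as [x| |]; intros [H0 HT]; simpl in *; [|now apply Rmax_right|easy].
now apply clamp_id.
Qed.

Lemma clampT_in T t : Rbar_lt 0 T -> in_horizon T (clampT T t).
Proof.
unfold in_horizon; destruct T as [x| |]; simpl; intros HT; [|split; [apply Rmax_l|easy]|easy].
apply clamp_in; lra.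
Qed.

Lemma clampT_Lipschitz T s t : Rabs (clampT T s - clampT T t) <= Rabs (s - t).
Proof.
destruct T as [x| |]; simpl; unfold Rmax, Rmin, Rabs;
repeat (destruct Rle_dec || destruct Rcase_abs); lra.
Qed.

Lemma continuous_clampT T t : continuous (clampT T) t.
Proof.
apply continuity_pt_filterlim; intros eps Heps; exists eps; split; [lra|].
intros y [_ Hy]; simpl in *; unfold Rdist in *.
apply Rle_lt_trans with (1 := clampT_Lipschitz T y t), Hy.
Qed.

Lemma continuous_on_clampT T (f : R -> R) t : Rbar_lt 0 T ->
  continuous_on (in_horizon T) f -> continuous (fun s => f (clampT T s)) t.
Proof.
intros HT Hf.
apply (fun H => filterlim_comp _ _ _ (clampT T) f _ _ _ H (Hf (clampT T t) (clampT_in T t HT))).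
intros P HP; change (locally t (fun s => P (clampT T s))).
apply (filter_imp (fun s => in_horizon T (clampT T s) -> P (clampT T s))).
  intros s Hs; apply Hs, clampT_in, HT.
exact (continuous_clampT T t _ HP).
Qed.

Lemma in_horizon_interior T (t : R) : 0 < t -> Rbar_lt t T ->
  exists X, t < X /\ in_horizon T X.
Proof.
unfold in_horizon; destruct T as [x| |]; simpl; intros H0 HT; [|exists (t + 1)|easy].
  exists x; lra.
split; [lra|split; [lra|easy]].
Qed.

Lemma clampT_locally T (t : R) : 0 < t -> Rbar_lt t T ->
  locally t (fun s => clampT T s = s).
Proof.
intros H0 HT; destruct (in_horizon_interior T t H0 HT) as [X [HtX [_ HX]]].
generalize (locally_between 0 X t (conj H0 HtX)); apply filter_imp.
intros s Hs; apply clampT_id; split; [lra|].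
apply Rbar_le_trans with X; simpl; auto; lra.
Qed.

(** This allows the adoption level to be taken continuous on the whole line: clamping changes
    nothing near an interior time, so the equation survives. *)
Lemma adoption_level_clamp p q T sp sq f : Rbar_lt 0 T ->
  adoption_level p q T sp sq f ->
  adoption_level p q T sp sq (fun t => f (clampT T t)).
Proof.
intros HT [Hc [H0 Hd]]; split; [|split].
- intros t _; apply (filterlim_filter_le_1 (F := locally t)).
    apply filter_le_within.
  apply continuous_on_clampT; auto.
- rewrite clampT_id; [exact H0|split; [lra|now apply Rbar_lt_le]].
- intros t Ht0 HtT Hsp Hsq.
  rewrite clampT_id by (split; [lra|now apply Rbar_lt_le]).
  apply (is_derive_ext_loc f); [|now apply Hd].
  generalize (clampT_locally T t Ht0 HtT); apply filter_imp.
  intros s Hs; now rewrite Hs.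
Qed.

Instance horizon_end_filter T : ProperFilter (horizon_end T).
Proof. unfold horizon_end; destruct T; typeclasses eauto. Qed.

(** The profit sees [f] only through [Derive f] at interior times, near which clamping is the
    identity. *)
Lemma is_profit_clamp gamma theta T sp sq f v : Rbar_lt 0 T ->
  is_profit gamma theta T sp sq f v ->
  is_profit gamma theta T sp sq (fun t => f (clampT T t)) v.
Proof.
intros HT; apply is_RInt_gen_ext.
assert (HF : horizon_end T (fun b => 0 <= b /\ Rbar_le b T)).
  destruct T as [x| |]; [|exists 0|easy]; unfold horizon_end, at_point;
    simpl in *; intros; split; try lra; easy.
apply Filter_prod with (Q := fun a => a = 0) (2 := HF); [reflexivity|].
intros a b -> [Hb HbT] t; simpl; rewrite Rmin_left, Rmax_right by exact Hb.
intros Ht; rewrite (Derive_ext_loc f (fun t => f (clampT T t))); [reflexivity|].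
apply filter_imp with (fun s => clampT T s = s).
  intros s Hs; now rewrite Hs.
apply clampT_locally; [lra|].
apply Rbar_lt_le_trans with b; [simpl; lra|exact HbT].
Qed.

Section AdoptionLevel.

Variables (p q : R -> R) (T : Rbar) (sp sq f : R -> R).
Hypotheses (Hp : forall x, continuous p x) (Hq : forall x, continuous q x).
Hypothesis Hp0 : forall x, 0 <= p x.
Hypotheses (Hsp : piecewise_continuous T sp) (Hsq : piecewise_continuous T sq).
Hypothesis Hf : adoption_level p q T sp sq f.
Hypothesis Hfc : forall t, in_horizon T t -> continuous f t.

(** On a piece the equation gets coefficients [P] and [Q] that are continuous everywhere, so
    integrating factors can be formed from them. *)
Lemma adoption_level_piece (a b : R) : 0 <= a -> a < b -> Rbar_le b T ->
  extends_continuously sp a b -> extends_continuously sq a b ->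
  exists P Q : R -> R,
    (forall t, continuous P t) /\ (forall t, continuous Q t) /\
    (forall t, 0 <= P t) /\
    forall t, a < t < b -> is_derive f t ((1 - f t) * (P t + Q t * f t)).
Proof.
intros Ha Hab HbT [gp [Hgp Hspp]] [gq [Hgq Hsqq]].
exists (fun t => p (gp t)), (fun t => q (gq t)).
split; [intros t; now apply continuous_Rcomp|].
split; [intros t; now apply continuous_Rcomp|].
split; [intros t; apply Hp0|].
intros t Ht; rewrite <- Hspp, <- Hsqq by exact Ht.
assert (Hloc : forall s g : R -> R, (forall t, continuous g t) ->
    (forall t, a < t < b -> s t = g t) -> continuous s t).
  intros s g Hg Hs; apply (continuous_ext_loc s g); [|apply Hg].
  generalize (locally_between a b t Ht); apply filter_imp.
  intros y Hy; symmetry; now apply Hs.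
destruct Hf as [_ [_ Hd]]; apply Hd; [lra| |now apply Hloc with gp|now apply Hloc with gq].
apply Rbar_lt_le_trans with b; [simpl; lra|exact HbT].
Qed.

Lemma in_horizon_le (X t : R) : Rbar_le X T -> 0 <= t <= X -> in_horizon T t.
Proof.
intros HX Ht; split; [lra|].
apply Rbar_le_trans with X; [simpl; lra|exact HX].
Qed.

Lemma horizon_ind (Q : R -> R -> Prop) (X : R) : 0 < X -> Rbar_le X T ->
  (forall a m b, 0 <= a -> a < m < b -> b <= X -> Q a m -> Q m b -> Q a b) ->
  (forall a b, 0 <= a -> a < b -> b <= X ->
     extends_continuously sp a b -> extends_continuously sq a b -> Q a b) ->
  Q 0 X.
Proof.
intros HX0 HX Hadd Hbase.
apply (joint_pieces_ind sp sq Q 0 X); auto;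
  [apply (proj1 (piecewise_continuous_pieces T sp))
  |apply (proj1 (piecewise_continuous_pieces T sq))]; auto.
Qed.

(** Along [f] the equation is linear in 1 - f: multiplied by the exponential of the integral of P +
    Q f, it is constant on each piece. Positivity thus passes from piece to piece. *)
Lemma adoption_level_lt_1 (X : R) : in_horizon T X -> f X < 1.
Proof.
intros [[HX0|<-] HX]; [|destruct Hf as [_ [-> _]]; lra].
enough (f 0 < 1 -> f X < 1) by (destruct Hf as [_ [Hf0 _]]; lra).
apply (horizon_ind (fun a b => f a < 1 -> f b < 1) X HX0 HX); [auto|].
intros a b Ha Hab HbX Hspp Hsqq Hfa.
assert (HbT : Rbar_le b T) by (apply Rbar_le_trans with X; auto).
destruct (adoption_level_piece a b Ha Hab HbT Hspp Hsqq)
  as [P [Q [HP [HQ [_ Hd]]]]].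
assert (Hab' : forall t, a <= t <= b -> continuous f t).
  intros t Ht; apply Hfc, in_horizon_le with b; auto; lra.
(* Freezing [f] outside [a, b] makes the coefficient [k] continuous everywhere, hence its primitive
   differentiable everywhere. *)
set (fc t := f (Rmax a (Rmin b t))).
assert (Hc : forall t, continuous fc t).
  intros t; apply (continuous_comp (fun t => Rmax a (Rmin b t)) f).
    apply continuous_clamp.
  apply Hab', clamp_in; lra.
set (k t := P t + Q t * fc t).
assert (Hk : forall t, continuous k t) by (intros t; unfold k; cont; auto).
assert (HK : forall t, is_derive (RInt k a) t (k t)).
  intros t; now apply is_derive_RInt_continuous.
assert (Heq : (1 - f a) * exp (RInt k a a) = (1 - f b) * exp (RInt k a b)).
  apply (derive_zero_open_eq (fun t => (1 - f t) * exp (RInt k a t))); auto.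
    intros t Ht; cont; [auto|apply is_derive_continuous with (k t), HK].
  intros t Ht; generalize (HK t) (Hd t Ht); generalize (RInt k a).
  intros K HKt Hft; der.
  unfold k, fc; rewrite clamp_id by lra; ring.
rewrite RInt_point in Heq; unfold zero in Heq; simpl in Heq.
rewrite exp_0, Rmult_1_r in Heq.
assert (0 < 1 - f b); [|lra].
apply Rmult_lt_reg_r with (exp (RInt k a b)); [apply exp_pos|lra].
Qed.

(** Writing f' = (1-f) P + Q (1-f) f, the product of f with exp(- int Q (1-f)) has derivative (1-f)
    P exp(- int Q (1-f)), which is nonnegative because f < 1. *)
Lemma adoption_level_ge_0 (X : R) : in_horizon T X -> 0 <= f X.
Proof.
intros [[HX0|<-] HX]; [|destruct Hf as [_ [-> _]]; lra].
enough (0 <= f 0 -> 0 <= f X) by (destruct Hf as [_ [Hf0 _]]; lra).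
apply (horizon_ind (fun a b => 0 <= f a -> 0 <= f b) X HX0 HX); [auto|].
intros a b Ha Hab HbX Hspp Hsqq Hfa.
assert (HbT : Rbar_le b T) by (apply Rbar_le_trans with X; auto).
destruct (adoption_level_piece a b Ha Hab HbT Hspp Hsqq)
  as [P [Q [HP [HQ [HP0 Hd]]]]].
assert (Hab' : forall t, a <= t <= b -> continuous f t).
  intros t Ht; apply Hfc, in_horizon_le with b; auto; lra.
set (fc t := f (Rmax a (Rmin b t))).
assert (Hc : forall t, continuous fc t).
  intros t; apply (continuous_comp (fun t => Rmax a (Rmin b t)) f).
    apply continuous_clamp.
  apply Hab', clamp_in; lra.
set (k t := Q t * (1 - fc t)).
assert (Hk : forall t, continuous k t) by (intros t; unfold k; cont; auto).
assert (HK : forall t, is_derive (RInt k a) t (k t)).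
  intros t; now apply is_derive_RInt_continuous.
assert (Hle : f a * exp (- RInt k a a) <= f b * exp (- RInt k a b)).
  apply (derive_nonneg_open_le (fun t => f t * exp (- RInt k a t))
           (fun t => (1 - f t) * P t * exp (- RInt k a t))); auto.
  - intros t Ht; cont; [auto|apply is_derive_continuous with (k t), HK].
  - intros t Ht; generalize (HK t) (Hd t Ht); generalize (RInt k a).
    intros K HKt Hft; der.
    unfold k, fc; rewrite clamp_id by lra; ring.
  - intros t Ht; apply Rmult_le_pos; [|apply Rlt_le, exp_pos].
    apply Rmult_le_pos; [|apply HP0].
    enough (f t < 1) by lra.
    apply adoption_level_lt_1, in_horizon_le with b; auto; lra.
rewrite RInt_point in Hle; unfold zero in Hle; simpl in Hle.
rewrite Ropp_0, exp_0, Rmult_1_r in Hle.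
apply Rmult_le_reg_r with (exp (- RInt k a b)); [apply exp_pos|lra].
Qed.

(** Integration by parts on each piece. The boundary terms telescope because [f] is continuous
    across the jumps, and f(0) = 0 removes the one at 0. Profits can then be compared through [f]
    without its derivative. *)
Lemma revenue_by_parts (theta X : R) : 0 < X -> Rbar_le X T ->
  is_RInt (fun t => exp (- theta * t) * Derive f t) 0 X
    (exp (- theta * X) * f X + theta * RInt (fun t => exp (- theta * t) * f t) 0 X).
Proof.
intros HX0 HX.
enough (H : is_RInt (fun t => exp (- theta * t) * Derive f t) 0 X
    (exp (- theta * X) * f X - exp (- theta * 0) * f 0 +
     theta * RInt (fun t => exp (- theta * t) * f t) 0 X)).
  destruct Hf as [_ [Hf0 _]].
  rewrite Hf0, Rmult_0_r, Rminus_0_r in H; exact H.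
assert (Hint : forall a b, 0 <= a -> a < b -> b <= X ->
    forall t, a <= t <= b -> continuous (fun t => exp (- theta * t) * f t) t).
  intros a b Ha Hab HbX t Ht; cont.
  apply Hfc, in_horizon_le with X; auto; lra.
assert (Hex : forall a b, 0 <= a -> a < b -> b <= X ->
    ex_RInt (fun t => exp (- theta * t) * f t) a b).
  intros a b Ha Hab HbX; apply (ex_RInt_continuous (V := R_CompleteNormedModule)).
  rewrite Rmin_left, Rmax_right by lra; now apply Hint.
apply (horizon_ind (fun a b => is_RInt (fun t => exp (- theta * t) * Derive f t) a b
    (exp (- theta * b) * f b - exp (- theta * a) * f a +
     theta * RInt (fun t => exp (- theta * t) * f t) a b)) X HX0 HX).
  intros a m b Ha Hm HbX Ham Hmb.
  rewrite <- (RInt_Chasles _ a m b) by (apply Hex; lra).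
  evar_last; [exact (is_RInt_Chasles _ _ _ _ _ _ Ham Hmb)|].
  unfold plus; simpl; ring.
intros a b Ha Hab HbX Hspp Hsqq.
assert (HbT : Rbar_le b T) by (apply Rbar_le_trans with X; auto).
destruct (adoption_level_piece a b Ha Hab HbT Hspp Hsqq)
  as [P [Q [HP [HQ [_ Hd]]]]].
assert (Hab' : forall t, a <= t <= b -> continuous f t).
  intros t Ht; apply Hfc, in_horizon_le with b; auto; lra.
set (phi t := exp (- theta * t) * ((1 - f t) * (P t + Q t * f t))).
assert (Hphi : is_RInt (fun t => phi t - theta * (exp (- theta * t) * f t)) a b
    (exp (- theta * b) * f b - exp (- theta * a) * f a)).
  apply (FTC_open (fun t => exp (- theta * t) * f t)); auto.
  - apply Hint; lra.
  - intros t Ht; unfold phi; cont; auto.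
  - intros t Ht; generalize (Hd t Ht); intros Hft.
    der; unfold phi; ring.
apply (is_RInt_ext (fun t => plus (phi t - theta * (exp (- theta * t) * f t))
    (scal theta (exp (- theta * t) * f t)))).
  rewrite Rmin_left, Rmax_right by lra; intros t Ht.
  rewrite (is_derive_unique _ _ _ (Hd t Ht)).
  unfold plus, scal; simpl; unfold mult; simpl; unfold phi; ring.
apply (is_RInt_plus (V := R_NormedModule)); [exact Hphi|].
apply (is_RInt_scal (V := R_NormedModule)).
apply (RInt_correct (V := R_CompleteNormedModule)), Hex; auto.
Qed.

End AdoptionLevel.

(** * Perturbations near time 0 *)

Lemma piece_of_continuous (s : R -> R) (a b : R) : a < b ->
  (forall t, a <= t <= b -> continuous s t) -> piece s a b.
Proof.
intros Hab Hs; split; [exact Hab|split; [|split]].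
- intros t Ht; apply Hs; lra.
- intros P HP; apply filter_le_within, (Hs a ltac:(lra)), HP.
- exists (s b); intros P HP; apply filter_le_within, (Hs b ltac:(lra)), HP.
Qed.

(** * Limits at the end of the horizon *)

Lemma is_RInt_gen_horizon (D G : R -> R) (T : Rbar) (c l : R) :
  0 <= c -> Rbar_le c T ->
  (forall X : R, c <= X -> Rbar_le X T -> is_RInt D 0 X (G X)) ->
  filterlim G (horizon_end T) (locally l) ->
  is_RInt_gen D (at_point 0) (horizon_end T) l.
Proof.
intros Hc HcT HD HG P HP; unfold filtermapi.
assert (HF : horizon_end T (fun X => c <= X /\ Rbar_le X T)).
  destruct T as [x| |]; [|exists c|easy]; unfold horizon_end, at_point;
    simpl in *; intros; split; try lra; easy.
apply Filter_prod with (Q := fun a => a = 0)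
  (R := fun X => (c <= X /\ Rbar_le X T) /\ P (G X)).
- reflexivity.
- apply filter_and; [exact HF|exact (HG P HP)].
- intros a X -> [[HcX HXT] HPG]; exists (G X); split; [|exact HPG].
  now apply HD.
Qed.

Lemma monotone_bounded_lim (I : R -> R) (c M : R) :
  (forall x y, c <= x -> x <= y -> I x <= I y) -> (forall x, c <= x -> I x <= M) ->
  exists l, filterlim I (Rbar_locally p_infty) (locally l) /\
    forall x, c <= x -> I x <= l.
Proof.
intros Hmon HM.
destruct (completeness (fun z => exists x, c <= x /\ z = I x)) as [l [Hub Hlub]].
  exists M; intros z [x [Hx ->]]; now apply HM.
  exists (I c), c; split; [lra|reflexivity].
assert (Hl : forall x, c <= x -> I x <= l) by (intros x Hx; apply Hub; eauto).
exists l; split; [|exact Hl].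
apply filterlim_locally; intros eps.
assert (Hex : exists x, c <= x /\ l - eps < I x).
  apply Classical_Prop.NNPP; intros Hno.
  assert (l <= l - eps); [|destruct eps; simpl in *; lra].
  apply Hlub; intros z [x [Hx ->]]; apply Rnot_lt_le; intros Hlt; apply Hno; eauto.
destruct Hex as [x [Hx Hlx]]; exists x; intros y Hy.
unfold ball; simpl; unfold AbsRing_ball, abs, minus, plus, opp; simpl.
assert (I x <= I y) by (apply Hmon; lra).
assert (I y <= l) by (apply Hl; lra).
apply Rabs_def1; destruct eps; simpl in *; lra.
Qed.

Lemma exp_le_compat x y : x <= y -> exp x <= exp y.
Proof. intros [Hxy| ->]; [now apply Rlt_le, exp_increasing|lra]. Qed.

Lemma exp_decay_lim (d : R -> R) (theta : R) : 0 < theta ->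
  (forall t, 0 <= t -> Rabs (d t) <= 1) ->
  filterlim (fun t => exp (- theta * t) * d t) (Rbar_locally p_infty) (locally 0).
Proof.
intros Htheta Hd; apply filterlim_locally; intros eps.
exists (Rmax 0 (- ln eps / theta)); intros t Ht.
assert (Ht0 : 0 < t) by (apply Rle_lt_trans with (2 := Ht), Rmax_l).
assert (Hte : - ln eps / theta < t) by (apply Rle_lt_trans with (2 := Ht), Rmax_r).
assert (Hexp : exp (- theta * t) < eps).
  rewrite <- (exp_ln eps) by apply cond_pos; apply exp_increasing.
  apply (Rmult_lt_compat_l theta) in Hte; [|exact Htheta].
  replace (theta * (- ln eps / theta)) with (- ln eps) in Hte by (field; lra).
  lra.
unfold ball; simpl; unfold AbsRing_ball, abs, minus, plus, opp; simpl.
rewrite Ropp_0, Rplus_0_r, Rabs_mult, Rabs_pos_eq by apply Rlt_le, exp_pos.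
apply Rle_lt_trans with (2 := Hexp).
rewrite <- (Rmult_1_r (exp (- theta * t))) at 2.
apply Rmult_le_compat_l; [apply Rlt_le, exp_pos|apply Hd; lra].
Qed.

(** * The optimal promotion and its factor E *)

Section Optimum.

Variables (p0 q0 bp bq gamma theta : R) (T : Rbar) (sp sq f : R -> R).
Hypotheses (hp0 : 0 < p0) (hq0 : 0 < q0) (hbp : 0 < bp) (hbq : 0 < bq).
Hypotheses (hgamma : 0 < gamma) (htheta : 0 <= theta) (hT : Rbar_lt 0 T).

Let p x := p0 + bp * sqrt x.
Let q x := q0 + bq * sqrt x.

Hypotheses (Hsp : promotion T sp) (Hsq : promotion T sq).
Hypothesis Hf : adoption_level p q T sp sq f.
Hypothesis Hfc : forall t, continuous f t.

Lemma p_continuous x : continuous p x.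
Proof. unfold p; cont; apply continuous_sqrt. Qed.

Lemma q_continuous x : continuous q x.
Proof. unfold q; cont; apply continuous_sqrt. Qed.

Lemma p_ge_0 x : 0 <= p x.
Proof.
unfold p; generalize (Rmult_le_pos bp (sqrt x) ltac:(lra) (sqrt_pos x)); lra.
Qed.

Lemma q_ge_q0 x : q0 <= q x.
Proof.
unfold q; generalize (Rmult_le_pos bq (sqrt x) ltac:(lra) (sqrt_pos x)); lra.
Qed.

Lemma q_ge_0 x : 0 <= q x.
Proof. generalize (q_ge_q0 x); lra. Qed.

Lemma f_lt_1 t : in_horizon T t -> f t < 1.
Proof.
apply (adoption_level_lt_1 p q T sp sq f p_continuous q_continuous p_ge_0
  (proj1 Hsp) (proj1 Hsq) Hf); auto.
Qed.

Lemma f_ge_0 t : in_horizon T t -> 0 <= f t.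
Proof.
apply (adoption_level_ge_0 p q T sp sq f p_continuous q_continuous p_ge_0
  (proj1 Hsp) (proj1 Hsq) Hf); auto.
Qed.

Definition rate t := (q0 + bq * sqrt (sq t)) * (1 - f t).

Lemma rate_ge_0 t : in_horizon T t -> 0 <= rate t.
Proof.
intros Ht; apply Rmult_le_pos; [apply q_ge_0|generalize (f_lt_1 t Ht); lra].
Qed.

Lemma ex_RInt_rate (a b : R) : 0 <= a -> a <= b -> Rbar_le b T -> ex_RInt rate a b.
Proof.
intros Ha [Hab|<-] Hb; [|apply ex_RInt_point].
(* The induction over pieces starts at 0, so integrability is proved on [0, b] and then
   restricted. *)
apply (ex_RInt_Chasles_2 (V := R_CompleteNormedModule)) with 0; [lra|].
apply (horizon_ind T sp sq (proj1 Hsp) (proj1 Hsq) (ex_RInt rate) b); [lra|exact Hb| |].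
  intros x m y _ _ _; apply ex_RInt_Chasles.
intros x y Hx Hxy Hyb _ [gq [Hgq Hs]].
apply (ex_RInt_ext (fun t => q (gq t) * (1 - f t))).
  rewrite Rmin_left, Rmax_right by lra.
  intros t Ht; unfold rate; now rewrite Hs.
apply (ex_RInt_continuous_everywhere (fun t => q (gq t) * (1 - f t))).
intros t; cont; [|apply Hfc].
apply (continuous_Rcomp gq q); [exact q_continuous|apply Hgq].
Qed.

(** This is the factor E. Clamping keeps it constant outside the horizon, hence continuous on all of
    R. *)
Definition growth t := exp (RInt rate 0 (clampT T t)).

(** [rate] may jump but is bounded on bounded parts of the horizon, so its integral is Lipschitz
    there, and [clampT] is 1-Lipschitz. *)
Lemma RInt_rate_continuous t : continuous (fun t => RInt rate 0 (clampT T t)) t.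
Proof.
(* [X] bounds the clamped times near [t]: the horizon itself if finite, otherwise a point one unit
   further on. *)
assert (HX : exists X, 0 <= X /\ Rbar_le X T /\
    locally t (fun s => clampT T s <= X)).
  destruct T as [x| |]; [|exists (Rmax 0 t + 1)|easy].
    exists x; split; [simpl in hT; lra|split; [simpl; lra|]].
    apply filter_forall; intros s; apply clamp_in; simpl in hT; lra.
  split; [generalize (Rmax_l 0 t); lra|split; [easy|]].
  exists (mkposreal 1 Rlt_0_1); intros s Hs; simpl.
  apply Rabs_def2 in Hs; unfold minus, plus, opp in Hs; simpl in Hs.
  unfold Rmax; repeat destruct Rle_dec; lra.
destruct HX as [X [HX0 [HXT Hloc]]].
destruct (ex_RInt_ub rate 0 X) as [M HM]; [apply ex_RInt_rate; auto; lra|].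
rewrite Rmin_left, Rmax_right in HM by lra.
assert (HM0 : 0 <= M).
  apply Rle_trans with (2 := HM 0 ltac:(lra)), norm_ge_0.
assert (Hlip : forall a b, 0 <= a -> a <= b -> b <= X ->
    Rabs (RInt rate 0 b - RInt rate 0 a) <= M * Rabs (b - a)).
  intros a b Ha Hab HbX.
  assert (HbT : Rbar_le b T) by (apply Rbar_le_trans with X; auto).
  assert (HaT : Rbar_le a T) by (apply Rbar_le_trans with b; simpl; auto).
  rewrite <- (RInt_Chasles rate 0 a b) by (apply ex_RInt_rate; auto; lra).
  unfold plus; simpl.
  rewrite (Rplus_minus_l (RInt rate 0 a)).
  rewrite (Rabs_pos_eq (b - a)), Rmult_comm by lra.
  apply abs_RInt_le_const; [exact Hab|now apply ex_RInt_rate|].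
  intros s Hs; apply HM; lra.
apply filterlim_locally; intros eps.
(* The Lipschitz constant [M] may be 0, hence the division by [M + 1]. *)
assert (Heps : 0 < eps / (M + 1)) by (apply Rdiv_lt_0_compat; [apply cond_pos|lra]).
assert (Hball : locally t (fun s => ball t (mkposreal _ Heps) s)) by apply locally_ball.
generalize (filter_and _ _ Hloc Hball); apply filter_imp; intros s [Hs Hb].
assert (HtX := locally_singleton _ _ Hloc).
unfold ball in *; simpl in *; unfold AbsRing_ball, abs, minus, plus, opp in *; simpl in *.
assert (Hcl := clampT_Lipschitz T s t).
assert (Hcs := clampT_in T s hT); assert (Hct := clampT_in T t hT).
apply Rle_lt_trans with (M * Rabs (clampT T s - clampT T t)).
  destruct (Rle_or_lt (clampT T t) (clampT T s)) as [Hle|Hlt].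
    apply Hlip; auto; apply Hct.
  rewrite (Rabs_minus_sym (clampT T s)).
  replace (_ + - _) with (- (RInt rate 0 (clampT T t) - RInt rate 0 (clampT T s))) by ring.
  rewrite Rabs_Ropp; apply Hlip; auto; [apply Hcs|lra].
apply Rle_lt_trans with (M * Rabs (s - t)).
  now apply Rmult_le_compat_l.
apply Rle_lt_trans with ((M + 1) * Rabs (s - t)).
  generalize (Rabs_pos (s - t)); lra.
apply (Rmult_lt_compat_l (M + 1)) in Hb; [|lra].
replace ((M + 1) * (eps / (M + 1))) with (pos eps) in Hb by (field; lra).
exact Hb.
Qed.

Lemma growth_continuous t : continuous growth t.
Proof. unfold growth; cont; apply RInt_rate_continuous. Qed.

Lemma growth_ge_1 t : 1 <= growth t.
Proof.
destruct (clampT_in T t hT) as [H0 HT].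
rewrite <- exp_0; unfold growth; apply exp_le_compat.
apply RInt_ge_0; [exact H0|now apply ex_RInt_rate|].
intros x Hx; apply rate_ge_0; split; [lra|].
apply Rbar_le_trans with (clampT T t); [simpl; lra|exact HT].
Qed.

Lemma growth_derive (t : R) : 0 < t -> Rbar_lt t T -> continuous sq t ->
  is_derive growth t (growth t * rate t).
Proof.
intros H0 HT Hc.
assert (Hid := clampT_locally T t H0 HT).
assert (Hd : is_derive (fun t => RInt rate 0 (clampT T t)) t (rate t)).
  apply is_derive_RInt with 0.
    destruct (in_horizon_interior T t H0 HT) as [X [HtX [_ HX]]].
    generalize (filter_and _ _ Hid (locally_between 0 X t (conj H0 HtX))).
    apply filter_imp; intros s [-> Hs].
    apply (RInt_correct (V := R_CompleteNormedModule)), ex_RInt_rate; try lra.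
    apply Rbar_le_trans with X; [simpl; lra|exact HX].
  unfold rate; cont; apply Hfc.
unfold growth at 1; evar_last; [apply is_derive_Rexp, Hd|].
unfold growth; ring.
Qed.

Variables (c0 v : R).
Hypotheses (Hsp0 : piece sp 0 c0) (Hsq0 : piece sq 0 c0) (Hc0T : Rbar_le c0 T).
Hypothesis hTtheta : T = p_infty -> 0 < theta.
Hypothesis Hv : is_profit gamma theta T sp sq f v.
Hypothesis Hmax : forall (sp' sq' f' : R -> R) (v' : R),
  promotion T sp' -> promotion T sq' -> adoption_level p q T sp' sq' f' ->
  is_profit gamma theta T sp' sq' f' v' -> v' <= v.

(** * The perturbed promotion, its adoption level and its profit *)

Section Perturbation.

Variables (c : R) (yd : R -> R).
Hypothesis Hc : 0 < c < c0.
Hypothesis Hyd : forall t, continuous yd t.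

(** This is y, whose derivative [yd] acts only up to time [c]; [damping] is then 1 + E y. *)
Definition window t := RInt yd 0 (Rmin t c).
Definition damping t := 1 + growth t * window t.
(** The increase of sqrt(s_p) that raises p by E y' / (1 + E y); the division by [bp] comes from p
    being affine in sqrt(s_p). *)
Definition bump t := growth t * yd t / (bp * damping t).
(** The strict comparison gives the value of [sp] at [c], in accordance with the right-limit
    convention at a jump. *)
Definition sp_pert t :=
  if Rlt_dec t c then (sqrt (sp t) + bump t) ^ 2 else sp t.
Definition f_pert t := 1 - (1 - f t) / damping t.

Hypothesis Hdamping : forall t, 0 <= t <= c -> 0 < damping t.
Hypothesis Hend : 0 <= RInt yd 0 c.
Hypothesis Hbump : forall t, 0 <= t <= c -> 0 <= sqrt (sp t) + bump t.

Lemma lt_horizon (t : R) : t <= c -> Rbar_lt t T.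
Proof. intros Ht; apply Rbar_lt_le_trans with c0; [simpl; lra|exact Hc0T]. Qed.

Lemma le_horizon (t : R) : t <= c -> Rbar_le t T.
Proof. intros Ht; now apply Rbar_lt_le, lt_horizon. Qed.

Lemma window_continuous t : continuous window t.
Proof.
apply (continuous_comp (fun t => Rmin t c) (RInt yd 0)).
  apply continuous_ext with (fun t => Rmax (Rmin t c) (Rmin c (Rmin t c))).
    intros x; unfold Rmax, Rmin; repeat destruct Rle_dec; lra.
  apply continuity_pt_filterlim; intros eps Heps; exists eps; split; [lra|].
  intros y [_ Hy]; simpl in *; unfold Rdist in *.
  apply Rabs_def2 in Hy; apply Rabs_def1; unfold Rmax, Rmin;
  repeat destruct Rle_dec; lra.
apply is_derive_continuous with (yd (Rmin t c)).
now apply is_derive_RInt_continuous.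
Qed.

Lemma damping_continuous t : continuous damping t.
Proof. unfold damping; cont; [apply growth_continuous|apply window_continuous]. Qed.

Lemma damping_after t : c <= t -> 1 <= damping t.
Proof.
intros Ht; unfold damping, window; rewrite Rmin_right by exact Ht.
assert (Hg := growth_ge_1 t).
assert (0 <= growth t * RInt yd 0 c); [apply Rmult_le_pos|]; lra.
Qed.

Lemma damping_pos t : 0 <= t -> 0 < damping t.
Proof.
intros Ht; destruct (Rle_or_lt t c) as [Htc|Htc]; [apply Hdamping; lra|].
generalize (damping_after t ltac:(lra)); lra.
Qed.

Lemma f_pert_continuous t : 0 <= t -> continuous f_pert t.
Proof.
intros Ht; unfold f_pert; cont; [apply Hfc|apply damping_continuous|].
generalize (damping_pos t Ht); lra.
Qed.

Lemma sp_pert_sqrt t : 0 <= t ->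
  sqrt (sp_pert t) = sqrt (sp t) + if Rlt_dec t c then bump t else 0.
Proof.
intros Ht; unfold sp_pert; destruct Rlt_dec as [Htc|Htc]; [|ring].
rewrite sqrt_pow2; [reflexivity|apply Hbump; lra].
Qed.

(** With [g] for [sp], the perturbed square is continuous also at 0 and [c], which yields the
    one-sided limits of [sp_pert] there. *)
Lemma sp_pert_extension : exists g : R -> R,
  (forall t, continuous g t) /\ (forall t, 0 <= t < c0 -> sp t = g t) /\
  (forall t, 0 <= t -> continuous (fun t => (sqrt (g t) + bump t) ^ 2) t).
Proof.
destruct (piece_extension sp 0 c0 Hsp0) as [g [Hg Hspg]].
exists g; split; [exact Hg|split; [exact Hspg|]].
intros t Ht.
assert (Hcont : continuous (fun t => sqrt (g t) + bump t) t).
  cont; [apply Hg|unfold bump; cont].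
  - apply growth_continuous.
  - apply Hyd.
  - apply damping_continuous.
  - generalize (damping_pos t Ht); intros Hd; apply Rgt_not_eq, Rmult_lt_0_compat; lra.
simpl; apply (continuous_Rmult (fun t => sqrt (g t) + bump t)); [exact Hcont|].
apply (continuous_Rmult (fun t => sqrt (g t) + bump t)); [exact Hcont|].
apply continuous_const.
Qed.

Lemma sp_pert_promotion : promotion T sp_pert.
Proof.
split.
  destruct sp_pert_extension as [g [_ [Hspg Hh]]].
  assert (Hpiece : forall X, 0 < X <= c -> piece sp_pert 0 X).
    intros X HX; apply (piece_ext (fun t => (sqrt (g t) + bump t) ^ 2)).
      intros t Ht; unfold sp_pert; destruct Rlt_dec as [_|Htc]; [|lra].
      rewrite Hspg by lra; reflexivity.
    apply piece_of_continuous; [lra|intros t Ht; apply Hh; lra].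
  apply (proj2 (piecewise_continuous_pieces T sp_pert)); intros X HX HXT.
  destruct (Rle_or_lt X c) as [HXc|HcX]; [apply pieces_last, Hpiece; lra|].
  apply pieces_cons with c; [apply Hpiece; lra|].
  apply (pieces_ext sp).
    intros t Ht; unfold sp_pert; destruct Rlt_dec as [Htc|_]; [lra|reflexivity].
  apply (pieces_split sp 0 c X); [lra|].
  now apply (proj1 (piecewise_continuous_pieces T sp) (proj1 Hsp)).
intros t Ht; unfold sp_pert; destruct Rlt_dec; [apply pow2_ge_0|].
now apply Hsp.
Qed.

(* The window is left at time c, where f_pert is differentiable only if yd c = 0. *)
Lemma window_derive t : t <> c \/ yd c = 0 ->
  is_derive window t (if Rlt_dec t c then yd t else 0).
Proof.
intros Hor; destruct Rlt_dec as [Htc|Htc].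
  apply (is_derive_ext_loc (RInt yd 0)); [|now apply is_derive_RInt_continuous].
  assert (Hloc := open_lt c t Htc); revert Hloc; apply filter_imp.
  intros s Hs; unfold window; rewrite Rmin_left; [reflexivity|lra].
destruct (Req_dec t c) as [->|Hne].
  destruct Hor as [Hne|H0]; [easy|].
  assert (HY : is_derive (RInt yd 0) c (yd c)) by now apply is_derive_RInt_continuous.
  rewrite H0 in HY; split; [apply is_linear_scal_l|].
  intros x Hx; destruct HY as [_ HY]; intros eps.
  generalize (HY x Hx eps); apply filter_imp; intros s Hs.
  replace x with c in * by (apply is_filter_lim_locally_unique, Hx).
  unfold window; rewrite (Rmin_left c c) by lra.
  destruct (Rle_or_lt s c) as [Hsc|Hsc]; [rewrite Rmin_left by lra; exact Hs|].
  rewrite Rmin_right by lra.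
  match goal with |- norm ?z <= _ => replace z with (@zero R_NormedModule) end.
    rewrite norm_zero; apply Rmult_le_pos; [apply Rlt_le, cond_pos|apply norm_ge_0].
  unfold minus, plus, opp, scal, zero; simpl; unfold mult; simpl; ring.
apply (is_derive_ext_loc (fun _ => RInt yd 0 c)); [|apply is_derive_Rconst].
assert (Hloc := open_gt c t ltac:(lra)); revert Hloc; apply filter_imp.
intros s Hs; unfold window; rewrite Rmin_right; [reflexivity|lra].
Qed.

(** Continuity equates the left limit of [sp_pert] at [c] with [sp c]; comparing nonnegative roots
    gives [bump c = 0]. Hence whenever the adoption equation is imposed at [c], [f_pert] is
    differentiable there. *)
Lemma sp_pert_continuous_end : continuous sp_pert c -> yd c = 0.
Proof.
intros Hcont; destruct sp_pert_extension as [g [_ [Hspg Hh]]].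
assert (Hsc : sp_pert c = sp c) by (unfold sp_pert; destruct Rlt_dec; lra).
assert (Heq : sp c = (sqrt (sp c) + bump c) ^ 2).
  rewrite (Hspg c) at 2 by lra; rewrite <- Hsc.
  apply (filterlim_locally_unique (F := at_left c) (V := R_NormedModule) sp_pert).
    intros P HP; apply filter_le_within, Hcont, HP.
  apply filterlim_ext_loc with (fun t => (sqrt (g t) + bump t) ^ 2).
    exists (mkposreal c (proj1 Hc)); intros t Ht Htc; unfold sp_pert.
    apply Rabs_def2 in Ht; unfold minus, plus, opp in Ht; simpl in Ht.
    destruct Rlt_dec as [_|]; [rewrite Hspg by lra; reflexivity|lra].
  intros P HP; apply filter_le_within, (Hh c ltac:(lra)), HP.
assert (Hs0 : 0 <= sp c).
  apply Hsp; split; [lra|apply le_horizon; lra].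
assert (Hb : bump c = 0).
  generalize (sqrt_pow2 _ (Hbump c ltac:(lra))); rewrite <- Heq; lra.
unfold bump in Hb.
assert (Hg := growth_ge_1 c); assert (Hd := damping_pos c ltac:(lra)).
apply (f_equal (fun z => z * (bp * damping c))) in Hb.
replace (growth c * yd c / (bp * damping c) * (bp * damping c))
  with (growth c * yd c) in Hb by (field; lra).
rewrite Rmult_0_l in Hb; apply Rmult_integral in Hb; lra.
Qed.

Lemma f_pert_adoption : adoption_level p q T sp_pert sq f_pert.
Proof.
split; [|split].
- intros t [Ht _] P HP; apply filter_le_within, (f_pert_continuous t Ht), HP.
- destruct Hf as [_ [Hf0 _]]; unfold f_pert, damping, window.
  rewrite Hf0, Rmin_left, RInt_point by lra; unfold zero; simpl; field.
- intros t Ht HtT Hspt Hsqt.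
  assert (Hor : t <> c \/ yd c = 0).
    destruct (Req_dec t c) as [->|Hne]; [right|now left].
    now apply sp_pert_continuous_end.
  (* Continuity is assumed of [sp_pert] only. For [sp] it holds anyway inside the first piece, and
     from [c0] on the two functions coincide locally. *)
  assert (Hspc : continuous sp t).
    destruct (Rlt_or_le t c0) as [Ht0|Ht0]; [apply Hsp0; lra|].
    apply (continuous_ext_loc sp sp_pert); [|exact Hspt].
    assert (Hloc := open_gt c t ltac:(lra)); revert Hloc; apply filter_imp.
    intros s Hs; unfold sp_pert; destruct Rlt_dec; [lra|reflexivity].
  assert (Hft := proj2 (proj2 Hf) t Ht HtT Hspc Hsqt).
  assert (HE := growth_derive t Ht HtT Hsqt).
  assert (Hy := window_derive t Hor).
  assert (HW := damping_pos t ltac:(lra)).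
  assert (HWne : damping t <> 0) by lra.
  unfold p at 1; rewrite sp_pert_sqrt by lra.
  assert (HWd : is_derive damping t (growth t * rate t * window t +
      growth t * (if Rlt_dec t c then yd t else 0))).
    unfold damping; der; apply Rplus_0_l.
  unfold f_pert at 1; der; [exact HWne|].
  replace (if Rlt_dec t c then bump t else 0) with
    (growth t * (if Rlt_dec t c then yd t else 0) / (bp * damping t))
    by (destruct Rlt_dec; unfold bump; field; lra).
  generalize (if Rlt_dec t c then yd t else 0); intros z.
  unfold f_pert, rate, p, q.
  (* Since E y = W - 1 for the damping W, the equation becomes an identity of rational functions in
     W. *)
  replace (growth t * _ * window t) with
    ((q0 + bq * sqrt (sq t)) * (1 - f t) * (damping t - 1))
    by (unfold damping; ring).
  field; lra.
Qed.

Definition gap t := f_pert t - f t.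

Lemma gap_eq t : 0 <= t -> gap t = (1 - f t) * (growth t * window t) / damping t.
Proof.
intros Ht; assert (HW := damping_pos t Ht).
unfold gap, f_pert; replace (growth t * window t) with (damping t - 1).
  field; lra.
unfold damping; ring.
Qed.

Lemma gap_ge_0 t : c <= t -> in_horizon T t -> 0 <= gap t.
Proof.
intros Hct Ht; rewrite gap_eq by lra.
assert (HW := damping_after t Hct).
apply Rdiv_le_0_compat; [|lra].
apply Rmult_le_pos; [generalize (f_lt_1 t Ht); lra|unfold damping in HW; lra].
Qed.

Lemma gap_le_1 t : c <= t -> in_horizon T t -> gap t <= 1.
Proof.
intros Hct Ht; unfold gap, f_pert.
assert (0 <= (1 - f t) / damping t).
  apply Rdiv_le_0_compat; [generalize (f_lt_1 t Ht); lra|apply damping_pos; lra].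
generalize (f_ge_0 t Ht); lra.
Qed.

Lemma gap_continuous t : 0 <= t -> continuous gap t.
Proof. intros Ht; unfold gap; cont; [now apply f_pert_continuous|apply Hfc]. Qed.

Lemma ex_RInt_gap (a b : R) : 0 <= a <= b -> ex_RInt (fun t => exp (- theta * t) * gap t) a b.
Proof.
intros Hab; apply (ex_RInt_continuous (V := R_CompleteNormedModule)).
rewrite Rmin_left, Rmax_right by lra; intros t Ht; cont.
apply gap_continuous; lra.
Qed.

Definition gap_int X := RInt (fun t => exp (- theta * t) * gap t) 0 X.
Definition extra_cost := RInt (fun t => exp (- theta * t) * (sp_pert t - sp t)) 0 c.

Lemma extra_cost_correct :
  is_RInt (fun t => exp (- theta * t) * (sp_pert t - sp t)) 0 c extra_cost.
Proof.
apply (RInt_correct (V := R_CompleteNormedModule)).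
destruct sp_pert_extension as [g [Hg [Hspg Hh]]].
apply (ex_RInt_ext (fun t => exp (- theta * t) * ((sqrt (g t) + bump t) ^ 2 - g t))).
  rewrite Rmin_left, Rmax_right by lra; intros t Ht.
  unfold sp_pert; destruct Rlt_dec as [_|]; [|lra].
  rewrite Hspg by lra; reflexivity.
apply (ex_RInt_continuous (V := R_CompleteNormedModule)).
rewrite Rmin_left, Rmax_right by lra; intros t Ht.
assert (H := Hh t ltac:(lra)); assert (H' := Hg t).
apply (continuous_Rmult (fun t => exp (- theta * t))); [cont|].
now apply (continuous_Rminus (fun t => (sqrt (g t) + bump t) ^ 2)).
Qed.

Lemma gap_int_mono x y : c <= x -> x <= y -> Rbar_le y T -> gap_int x <= gap_int y.
Proof.
intros Hcx Hxy HyT; unfold gap_int.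
rewrite <- (RInt_Chasles _ 0 x y) by (apply ex_RInt_gap; lra).
assert (0 <= RInt (fun t => exp (- theta * t) * gap t) x y).
  apply RInt_ge_0; [exact Hxy|apply ex_RInt_gap; lra|].
  intros t Ht; apply Rmult_le_pos; [apply Rlt_le, exp_pos|].
  apply gap_ge_0; [lra|split; [lra|]].
  apply Rbar_le_trans with y; [simpl; lra|exact HyT].
unfold plus; simpl; lra.
Qed.

Let D t := exp (- theta * t) * (gamma * Derive f_pert t - sp_pert t - sq t) -
           exp (- theta * t) * (gamma * Derive f t - sp t - sq t).

(** Both revenues are integrated by parts, and the costs differ only before [c], which leaves
    [extra_cost] for every such horizon [X]. *)
Lemma profit_gain (X : R) : c <= X -> Rbar_le X T ->
  is_RInt D 0 X (gamma * (exp (- theta * X) * gap X + theta * gap_int X) - extra_cost).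
Proof.
intros HcX HXT.
assert (Hf1 := revenue_by_parts p q T sp sq f p_continuous q_continuous p_ge_0
  (proj1 Hsp) (proj1 Hsq) Hf (fun t _ => Hfc t) theta X ltac:(lra) HXT).
assert (Hf2 := revenue_by_parts p q T sp_pert sq f_pert p_continuous q_continuous p_ge_0
  (proj1 sp_pert_promotion) (proj1 Hsq) f_pert_adoption
  (fun t Ht => f_pert_continuous t (proj1 Ht)) theta X ltac:(lra) HXT).
assert (Hcost : is_RInt (fun t => exp (- theta * t) * (sp_pert t - sp t)) 0 X extra_cost).
  rewrite <- (Rplus_0_r extra_cost); apply (is_RInt_Chasles (V := R_NormedModule)) with c.
    exact extra_cost_correct.
  apply (is_RInt_ext (fun _ => 0)).
    rewrite Rmin_left, Rmax_right by lra; intros t Ht.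
    unfold sp_pert; destruct Rlt_dec; [lra|].
    now rewrite Rminus_diag, Rmult_0_r.
  evar_last; [apply (is_RInt_const (V := R_NormedModule))|].
  unfold scal; simpl; unfold mult; simpl; ring.
assert (Hgap : gap_int X = RInt (fun t => exp (- theta * t) * f_pert t) 0 X -
    RInt (fun t => exp (- theta * t) * f t) 0 X).
  unfold gap_int.
  rewrite (RInt_ext _ (fun t => minus (exp (- theta * t) * f_pert t) (exp (- theta * t) * f t))).
    apply (RInt_minus (V := R_CompleteNormedModule));
    apply (ex_RInt_continuous (V := R_CompleteNormedModule));
    rewrite Rmin_left, Rmax_right by lra; intros t Ht; cont.
      apply f_pert_continuous; lra.
    apply Hfc.
  intros t _; unfold gap, minus, plus, opp; simpl; ring.
rewrite Hgap.
evar_last.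
  apply (is_RInt_ext (fun t => minus (scal gamma (minus (exp (- theta * t) * Derive f_pert t)
    (exp (- theta * t) * Derive f t))) (exp (- theta * t) * (sp_pert t - sp t)))).
    intros t _; unfold D, minus, plus, opp, scal; simpl; unfold mult; simpl; ring.
  apply (is_RInt_minus (V := R_NormedModule)); [|exact Hcost].
  apply (is_RInt_scal (V := R_NormedModule)).
  apply (is_RInt_minus (V := R_NormedModule)); [exact Hf2|exact Hf1].
unfold minus, plus, opp, scal; simpl; unfold mult; simpl; unfold gap; ring.
Qed.

(** If the gain converges to [l], the perturbed promotion has the convergent profit [v + l], so it
    is a competitor in the maximum. *)
Lemma gain_lim_le_0 l :
  filterlim (fun X => gamma * (exp (- theta * X) * gap X + theta * gap_int X) - extra_cost)
    (horizon_end T) (locally l) -> l <= 0.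
Proof.
intros Hl; enough (v + l <= v) by lra.
apply (Hmax sp_pert sq f_pert); [apply sp_pert_promotion|exact Hsq|apply f_pert_adoption|].
unfold is_profit.
apply (is_RInt_gen_ext (V := R_NormedModule) (fun t =>
  plus (exp (- theta * t) * (gamma * Derive f t - sp t - sq t)) (D t))).
  apply Filter_prod with (Q := fun _ => True) (R := fun _ => True);
    [easy|apply filter_true|].
  intros a b _ _ t _; unfold D, plus; simpl; ring.
apply (is_RInt_gen_plus (V := R_NormedModule)); [exact Hv|].
apply (is_RInt_gen_horizon D _ T c l (Rlt_le _ _ (proj1 Hc)) (le_horizon c (Rle_refl c))
  profit_gain Hl).
Qed.

Lemma variation_finite (X : R) : T = X ->
  gamma * (exp (- theta * X) * gap X + theta * gap_int X) <= extra_cost.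
Proof.
intros HTX.
enough (gamma * (exp (- theta * X) * gap X + theta * gap_int X) - extra_cost <= 0) by lra.
apply gain_lim_le_0; rewrite HTX; intros P HP; exact (locally_singleton _ _ HP).
Qed.

(** After [c] the gap is nonnegative, so the boundary term and the part of the integral beyond [X]
    may be dropped. For an infinite horizon the gain must first be shown to converge. *)
Lemma variation (X : R) : c <= X -> Rbar_le X T ->
  gamma * theta * gap_int X <= extra_cost.
Proof.
intros HcX HXT.
assert (HT : (exists x : R, T = x) \/ T = p_infty).
  destruct T as [x| |]; [left; now exists x|now right|easy].
destruct HT as [[x HT]|HT].
  assert (HxT : Rbar_le x T) by (rewrite HT; simpl; lra).
  assert (HX : X <= x) by (rewrite HT in HXT; exact HXT).
  apply Rle_trans with (2 := variation_finite x HT).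
  assert (Hm := gap_int_mono X x HcX HX HxT).
  assert (H0 : 0 <= gap x) by (apply gap_ge_0; [lra|split; [lra|exact HxT]]).
  rewrite Rmult_assoc; apply Rmult_le_compat_l; [lra|].
  assert (0 <= exp (- theta * x) * gap x).
    apply Rmult_le_pos; [apply Rlt_le, exp_pos|exact H0].
  generalize (Rmult_le_compat_l theta _ _ htheta Hm); lra.
assert (Hth := hTtheta HT).
assert (Hin : forall t, 0 <= t -> in_horizon T t).
  intros t Ht; rewrite HT; split; [exact Ht|easy].
(* The gap is at most 1 after [c], so the discounted integral beyond [c] is at most the integral of
   the discount factor, hence at most 1/theta. *)
destruct (monotone_bounded_lim gap_int c (gap_int c + / theta)) as [l [Hl Hle]].
- intros x y Hcx Hxy; apply gap_int_mono; auto; apply Hin; lra.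
- intros x Hcx; unfold gap_int at 1.
  rewrite <- (RInt_Chasles _ 0 c x) by (apply ex_RInt_gap; lra).
  apply Rplus_le_compat_l.
  apply Rle_trans with (- / theta * exp (- theta * x) - - / theta * exp (- theta * c)).
    apply (is_RInt_le (fun t => exp (- theta * t) * gap t) (fun t => exp (- theta * t)) c x);
      [exact Hcx| | |].
    + apply (RInt_correct (V := R_CompleteNormedModule)), ex_RInt_gap; lra.
    + apply (is_RInt_derive (fun t => - / theta * exp (- theta * t))).
        intros t _; der; field; lra.
      intros t _; cont.
    + intros t Ht; rewrite <- (Rmult_1_r (exp (- theta * t))) at 2.
      apply Rmult_le_compat_l; [apply Rlt_le, exp_pos|].
      apply gap_le_1; [|apply Hin]; lra.
  assert (Hec : exp (- theta * c) <= 1).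
    rewrite <- exp_0; apply exp_le_compat.
    generalize (Rmult_le_pos theta c htheta ltac:(lra)); lra.
  assert (Hi : 0 < / theta) by now apply Rinv_0_lt_compat.
  generalize (Rmult_le_pos _ _ (Rlt_le _ _ Hi) (Rlt_le _ _ (exp_pos (- theta * x)))).
  generalize (Rmult_le_compat_l _ _ _ (Rlt_le _ _ Hi) Hec); lra.
- apply Rle_trans with (gamma * theta * l).
    apply Rmult_le_compat_l; [apply Rmult_le_pos; lra|now apply Hle].
  enough (gamma * (0 + theta * l) - extra_cost <= 0) by lra.
  apply gain_lim_le_0; rewrite HT; unfold horizon_end.
  change (is_lim (fun X => gamma * (exp (- theta * X) * gap X + theta * gap_int X) - extra_cost)
    p_infty (gamma * (0 + theta * l) - extra_cost)).
  apply is_lim_minus'; [|apply is_lim_const].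
  apply (is_lim_scal_l (fun X => exp (- theta * X) * gap X + theta * gap_int X)
    gamma p_infty (0 + theta * l)).
  apply is_lim_plus'; [|apply (is_lim_scal_l gap_int theta p_infty l), Hl].
  (* The bounds 0 and 1 on the gap hold only from [c] on; the maximum with [c] makes them valid for
     all times. *)
  apply (is_lim_ext_loc (fun X => exp (- theta * X) * gap (Rmax X c))).
    exists c; intros x Hx; rewrite Rmax_left by lra; reflexivity.
  apply (exp_decay_lim (fun X => gap (Rmax X c)) theta Hth).
  intros t Ht; assert (Hmx := Rmax_r t c).
  apply Rabs_le; split; [|apply gap_le_1; [exact Hmx|apply Hin; lra]].
  generalize (gap_ge_0 _ Hmx (Hin (Rmax t c) ltac:(lra))); lra.
Qed.

End Perturbation.

(** * Positivity of the initial promotion *)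

Lemma continuous_bounded (g : R -> R) (a b : R) : a <= b ->
  (forall t, continuous g t) -> exists M, 0 < M /\ forall t, a <= t <= b -> Rabs (g t) <= M.
Proof.
intros Hab Hg.
destruct (ex_RInt_ub g a b (ex_RInt_continuous_everywhere g a b Hg)) as [M HM].
rewrite Rmin_left, Rmax_right in HM by exact Hab.
exists (Rmax 1 M); split; [apply Rlt_le_trans with (2 := Rmax_l 1 M); lra|].
intros t Ht; apply Rle_trans with (2 := Rmax_r 1 M); exact (HM t Ht).
Qed.

Lemma discount_le_1 t : 0 <= t -> exp (- theta * t) <= 1.
Proof.
intros Ht; rewrite <- exp_0; apply exp_le_compat.
generalize (Rmult_le_pos theta t htheta Ht); lra.
Qed.

Section ConstantKick.

Variables (c k M : R).
Hypotheses (Hc : 0 < c < c0) (Hk : 0 < k) (Hkc : k * c <= 1).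
Hypotheses (HM : 0 < M).

Let yd (_ : R) := k.

Lemma kick_window t : window c yd t = k * Rmin t c.
Proof.
unfold window, yd; rewrite RInt_const.
unfold scal; simpl; unfold mult; simpl; ring.
Qed.

Lemma kick_window_bounds t : 0 <= t -> 0 <= window c yd t <= 1.
Proof.
intros Ht; rewrite kick_window.
assert (Hmin : 0 <= Rmin t c <= c).
  split; [apply Rmin_glb; lra|apply Rmin_r].
split; [apply Rmult_le_pos; lra|].
apply Rle_trans with (2 := Hkc), Rmult_le_compat_l; lra.
Qed.

Lemma kick_damping t : 0 <= t -> growth t <= M -> 1 <= damping c yd t <= 1 + M.
Proof.
intros Ht HtM; unfold damping.
assert (Hw := kick_window_bounds t Ht); assert (Hg := growth_ge_1 t).
split; [generalize (Rmult_le_pos (growth t) (window c yd t)); lra|].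
apply Rplus_le_compat_l; rewrite <- (Rmult_1_r M).
apply Rmult_le_compat; lra.
Qed.

Lemma kick_bump t : 0 <= t -> growth t <= M -> 0 <= bump c yd t <= M * k / bp.
Proof.
intros Ht HtM; unfold bump, yd.
assert (Hd := kick_damping t Ht HtM); assert (Hg := growth_ge_1 t).
fold yd; set (d := damping c yd t) in *.
assert (Hbd : bp * 1 <= bp * d) by (apply Rmult_le_compat_l; lra).
split; [apply Rdiv_le_0_compat; [apply Rmult_le_pos|]; lra|].
apply Rmult_le_compat; [apply Rmult_le_pos; lra|apply Rlt_le, Rinv_0_lt_compat; lra
  |apply Rmult_le_compat_r; lra|apply Rinv_le_contravar; lra].
Qed.

Hypothesis HgM : forall t, 0 <= t <= c -> growth t <= M.

Lemma kick_damping_pos t : 0 <= t <= c -> 0 < damping c yd t.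
Proof. intros Ht; generalize (kick_damping t (proj1 Ht) (HgM t Ht)); lra. Qed.

Lemma kick_end : 0 <= RInt yd 0 c.
Proof.
unfold yd; rewrite RInt_const; unfold scal; simpl; unfold mult; simpl.
apply Rmult_le_pos; lra.
Qed.

Lemma kick_bump_ge_0 t : 0 <= t <= c -> 0 <= sqrt (sp t) + bump c yd t.
Proof.
intros Ht; generalize (kick_bump t (proj1 Ht) (HgM t Ht)) (sqrt_pos (sp t)); lra.
Qed.

Lemma kick_ex_RInt_gap (a b : R) : 0 <= a <= b ->
  ex_RInt (fun t => exp (- theta * t) * gap c yd t) a b.
Proof.
apply ex_RInt_gap;
  [intros; apply continuous_const|exact kick_damping_pos|exact kick_end].
Qed.

(** The numerator is bounded below by E >= 1, the denominator above by 1 + y E <= 1 + M, as y <= k c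
    <= 1. *)
Lemma kick_gap m t : 0 <= m <= 1 - f t -> 0 <= t -> growth t <= M ->
  m * window c yd t / (1 + M) <= gap c yd t.
Proof.
intros Hm Ht HtM; rewrite (gap_eq c yd kick_damping_pos kick_end t Ht).
assert (Hd := kick_damping t Ht HtM); assert (Hw := kick_window_bounds t Ht).
assert (Hg := growth_ge_1 t).
apply Rmult_le_compat;
  [apply Rmult_le_pos; lra|apply Rlt_le, Rinv_0_lt_compat; lra| |].
  apply Rmult_le_compat; try lra.
  rewrite <- (Rmult_1_l (window c yd t)) at 1; apply Rmult_le_compat_r; lra.
apply Rinv_le_contravar; lra.
Qed.

(** With u = sqrt(s_p) and b the bump, the cost density is at most 2 u b + b^2, where b <= M k /
    b_p; the discount factor is at most 1. *)
Lemma kick_cost s : (forall t, 0 < t < c -> sqrt (sp t) <= s) ->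
  extra_cost c yd <= c * (2 * s * (M * k / bp) + (M * k / bp) ^ 2).
Proof.
intros Hs.
evar_last.
  apply (is_RInt_le _ (fun _ => 2 * s * (M * k / bp) + (M * k / bp) ^ 2) 0 c _
    (c * (2 * s * (M * k / bp) + (M * k / bp) ^ 2)) ltac:(lra)
    (extra_cost_correct c yd Hc ltac:(intros; apply continuous_const) kick_damping_pos kick_end)).
    evar_last; [apply (is_RInt_const (V := R_NormedModule))|].
    unfold scal; simpl; unfold mult; simpl; ring.
  intros t Ht.
  assert (Hb := kick_bump t ltac:(lra) (HgM t ltac:(lra))).
  assert (Hst := Hs t Ht); assert (Hs0 := sqrt_pos (sp t)).
  assert (Hsp0' : 0 <= sp t).
    apply Hsp; split; [lra|apply le_horizon with c; auto; lra].
  unfold sp_pert; destruct Rlt_dec as [_|]; [|lra].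
  rewrite <- (sqrt_sqrt (sp t)) at 2 by exact Hsp0'.
  set (u := sqrt (sp t)) in *; set (b := bump c yd t) in *.
  set (B := M * k / bp) in *.
  replace ((u + b) ^ 2 - u * u) with (2 * (u * b) + b * b) by ring.
  assert (Hub : u * b <= s * B) by (apply Rmult_le_compat; lra).
  assert (Hbb : b * b <= B * B) by (apply Rmult_le_compat; lra).
  assert (Hub0 : 0 <= u * b) by (apply Rmult_le_pos; lra).
  assert (Hbb0 : 0 <= b * b) by (apply Rmult_le_pos; lra).
  apply Rle_trans with (1 * (2 * (u * b) + b * b)); [|lra].
  apply Rmult_le_compat_r; [lra|apply discount_le_1; lra].
reflexivity.
Qed.

End ConstantKick.

(* Optimality forces the extra cost to outweigh the extra revenue (left-hand side). *)
Lemma kick_revenue : exists X K, 0 < X /\ Rbar_le X T /\ 0 < K /\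
  forall c k M m, 0 < c < c0 -> c <= 1 -> 0 < k -> k * c <= 1 -> 0 < M -> 0 <= m ->
    (forall t, 0 <= t <= c -> growth t <= M) ->
    (forall t, 0 <= t <= X -> growth t <= M) ->
    (forall t, 0 <= t <= X -> m <= 1 - f t) ->
    K * (m * (k * c) / (1 + M)) <= extra_cost c (fun _ => k).
Proof.
assert (HT : (exists x : R, T = x) \/ T = p_infty).
  destruct T as [x| |]; [left; now exists x|now right|easy].
assert (Hgap : forall X c k M m, 0 < c < c0 -> 0 < k -> k * c <= 1 -> 0 < M -> 0 <= m ->
    (forall t, 0 <= t <= c -> growth t <= M) ->
    (forall t, 0 <= t <= X -> growth t <= M) ->
    (forall t, 0 <= t <= X -> m <= 1 - f t) ->
    forall t, 0 <= t <= X -> m * (k * Rmin t c) / (1 + M) <= gap c (fun _ => k) t).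
  intros X c k M m Hc Hk Hkc HM Hm HcM HXM Hfm t Ht.
  rewrite <- kick_window.
  apply kick_gap; auto; lra.
assert (Hpos : forall c k M m t, 0 < c -> 0 < k -> 0 < M -> 0 <= m -> 0 <= t ->
    0 <= m * (k * Rmin t c) / (1 + M)).
  intros c k M m t Hc Hk HM Hm Ht; apply Rdiv_le_0_compat; [|lra].
  assert (0 <= Rmin t c) by (apply Rmin_glb; lra).
  repeat apply Rmult_le_pos; lra.
destruct HT as [[x HT]|HT].
  (* For a finite horizon the discounted gap at the terminal time suffices; this covers theta = 0 as
     well. *)
  exists x, (gamma * exp (- theta * x)).
  assert (Hx : 0 < x) by (rewrite HT in hT; exact hT).
  assert (HxT : Rbar_le x T) by (rewrite HT; simpl; lra).
  split; [exact Hx|split; [exact HxT|split]].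
    apply Rmult_lt_0_compat; [lra|apply exp_pos].
  intros c k M m Hc Hc1 Hk Hkc HM Hm HcM HXM Hfm.
  apply Rle_trans with (2 := variation_finite c (fun _ => k) Hc
    ltac:(intros; apply continuous_const) (kick_damping_pos c k M Hc Hk Hkc HcM)
    (kick_end c k Hc Hk) (kick_bump_ge_0 c k M Hc Hk Hkc HcM) x HT).
  rewrite Rmult_assoc; apply Rmult_le_compat_l; [lra|].
  assert (Hcx : c <= x).
    assert (Hcx := le_horizon c Hc c ltac:(lra)); rewrite HT in Hcx; exact Hcx.
  assert (Hg := Hgap x c k M m Hc Hk Hkc HM Hm HcM HXM Hfm).
  assert (0 <= gap_int c (fun _ => k) x).
    apply RInt_ge_0; [lra| |].
      apply kick_ex_RInt_gap with M; auto; lra.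
    intros t Ht; apply Rmult_le_pos; [apply Rlt_le, exp_pos|].
    apply Rle_trans with (2 := Hg t ltac:(lra)), Hpos; lra.
  generalize (Rmult_le_pos _ _ htheta H); intros Hi.
  apply Rle_trans with (exp (- theta * x) * gap c (fun _ => k) x); [|lra].
  apply Rmult_le_compat_l; [apply Rlt_le, exp_pos|].
  rewrite <- (Rmin_right x c) at 1 by exact Hcx; apply Hg; lra.
(* For an infinite horizon the revenue collected on [1, 2] suffices: it lies after the kick because
   [c <= 1], and the discount factor there is at least exp(-2 theta). *)
exists 2, (gamma * theta * exp (- theta * 2)).
assert (Hth := hTtheta HT).
assert (H2T : Rbar_le 2 T) by (rewrite HT; easy).
split; [lra|split; [exact H2T|split]].
  apply Rmult_lt_0_compat; [apply Rmult_lt_0_compat; lra|apply exp_pos].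
intros c k M m Hc Hc1 Hk Hkc HM Hm HcM HXM Hfm.
apply Rle_trans with (2 := variation c (fun _ => k) Hc
  ltac:(intros; apply continuous_const) (kick_damping_pos c k M Hc Hk Hkc HcM)
  (kick_end c k Hc Hk) (kick_bump_ge_0 c k M Hc Hk Hkc HcM) 2 ltac:(lra) H2T).
rewrite Rmult_assoc; apply Rmult_le_compat_l; [apply Rmult_le_pos; lra|].
assert (Hg := Hgap 2 c k M m Hc Hk Hkc HM Hm HcM HXM Hfm).
assert (Hex : forall a b, 0 <= a <= b ->
    ex_RInt (fun t => exp (- theta * t) * gap c (fun _ => k) t) a b).
  intros a b Hab; apply kick_ex_RInt_gap with M; auto.
unfold gap_int; rewrite <- (RInt_Chasles _ 0 1 2) by (apply Hex; lra).
assert (0 <= RInt (fun t => exp (- theta * t) * gap c (fun _ => k) t) 0 1).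
  apply RInt_ge_0; [lra|apply Hex; lra|].
  intros t Ht; apply Rmult_le_pos; [apply Rlt_le, exp_pos|].
  apply Rle_trans with (2 := Hg t ltac:(lra)), Hpos; lra.
apply Rle_trans with (RInt (fun t => exp (- theta * t) * gap c (fun _ => k) t) 1 2);
  [|unfold plus; simpl; lra].
rewrite <- (Rmult_1_l (_ * _)); replace 1 with (2 - 1) at 1 by ring.
assert (Hconst : is_RInt (fun _ => exp (- theta * 2) * (m * (k * c) / (1 + M))) 1 2
    ((2 - 1) * (exp (- theta * 2) * (m * (k * c) / (1 + M))))).
  apply (is_RInt_const (V := R_NormedModule)).
apply (is_RInt_le _ _ 1 2 _ _ ltac:(lra) Hconst
  (RInt_correct (V := R_CompleteNormedModule) _ _ _ (Hex 1 2 ltac:(lra)))).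
intros t Ht.
assert (Hgt := Hg t ltac:(lra)); rewrite Rmin_right in Hgt by lra.
assert (Hp0t := Hpos c k M m t ltac:(lra) Hk HM Hm ltac:(lra)).
rewrite Rmin_right in Hp0t by lra.
apply Rmult_le_compat; [apply Rlt_le, exp_pos|exact Hp0t| |exact Hgt].
apply exp_le_compat; generalize (Rmult_lt_compat_l theta t 2 Hth ltac:(lra)); lra.
Qed.

Lemma sp_0_pos : 0 < sp 0.
Proof.
assert (H0 : 0 <= sp 0).
  apply Hsp; split; [lra|now apply Rbar_lt_le].
destruct H0 as [H0|H0]; [exact H0|exfalso].
destruct kick_revenue as [X [K [HX [HXT [HK Hkick]]]]].
destruct (continuous_bounded growth 0 (Rmax X 1)) as [M [HM HgM]].
  generalize (Rmax_r X 1); lra.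
  intros t; apply growth_continuous; auto.
assert (HgM' : forall t, 0 <= t <= Rmax X 1 -> growth t <= M).
  intros t Ht; apply Rle_trans with (1 := Rle_abs _), HgM, Ht.
destruct (continuity_ab_min (fun t => 1 - f t) 0 X) as [tm [Hmin Htm]]; [lra| |].
  intros t Ht; apply continuity_pt_filterlim.
  apply (continuous_Rminus (fun _ => 1) f); [apply continuous_const|apply Hfc].
set (m := 1 - f tm) in *.
assert (Hm : 0 < m).
  enough (f tm < 1) by (unfold m; lra).
  apply f_lt_1; auto; apply in_horizon_le with X; auto.
(* For a kick of size k = s on an interval where sqrt(s_p) <= s, the revenue bound is A s c and the
   cost bound is B s^2 c. *)
set (B := 2 * (M / bp) + (M / bp) ^ 2).
set (A := K * (m / (1 + M))).
assert (HA : 0 < A).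
  apply Rmult_lt_0_compat; [lra|apply Rdiv_lt_0_compat; lra].
assert (HMbp : 0 < M / bp) by (apply Rdiv_lt_0_compat; lra).
assert (HB : 0 < B) by (unfold B; generalize (pow_lt _ 2 HMbp); lra).
(* This makes B s at most A/2, so the cost bound falls strictly below the revenue bound; s <= 1 and
   c <= 1 give k c <= 1. *)
set (s := Rmin 1 (A / (2 * B))).
assert (HAB : 0 < A / (2 * B)) by (apply Rdiv_lt_0_compat; lra).
assert (Hs : 0 < s) by (apply Rmin_glb_lt; lra).
assert (Hs1 : s <= 1) by apply Rmin_l.
assert (HsB : s * B <= A / 2).
  replace (A / 2) with (A / (2 * B) * B) by (field; lra).
  apply Rmult_le_compat_r; [lra|apply Rmin_r].
destruct (piece_extension sp 0 c0 Hsp0) as [g [Hg Hspg]].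
assert (Hc0 : 0 < c0) by apply Hsp0.
(* Here the assumption s_p(0) = 0 enters: sqrt(s_p) stays below [s] for a short time. *)
assert (Hloc : locally 0 (fun t => sqrt (g t) < s)).
  assert (Hcg : continuous (fun t => sqrt (g t)) 0) by (cont; apply Hg).
  apply (Hcg (fun y => y < s)), open_lt.
  now rewrite <- Hspg, <- H0, sqrt_0 by lra.
destruct Hloc as [del Hdel].
assert (Hex : exists c, 0 < c /\ c < c0 /\ c <= 1 /\ c < del).
  exists (Rmin 1 (Rmin (c0 / 2) (del / 2))).
  assert (Hd := cond_pos del).
  assert (H1 := Rmin_l 1 (Rmin (c0 / 2) (del / 2))).
  assert (H2 := Rmin_r 1 (Rmin (c0 / 2) (del / 2))).
  assert (H3 := Rmin_l (c0 / 2) (del / 2)); assert (H4 := Rmin_r (c0 / 2) (del / 2)).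
  split; [repeat apply Rmin_glb_lt; lra|lra].
destruct Hex as [c [Hc [Hcc0 [Hc1 Hcd]]]].
assert (Hsc : s * c <= 1).
  rewrite <- (Rmult_1_l 1); apply Rmult_le_compat; lra.
assert (HcM : forall t, 0 <= t <= c -> growth t <= M).
  intros t Ht; apply HgM'; generalize (Rmax_r X 1); lra.
assert (Hlow := Hkick c s M m (conj Hc Hcc0) Hc1 Hs Hsc HM (Rlt_le _ _ Hm) HcM
  ltac:(intros t Ht; apply HgM'; generalize (Rmax_l X 1); lra) Hmin).
assert (Hup := kick_cost c s M (conj Hc Hcc0) Hs Hsc HcM s).
assert (Hsmall : forall t, 0 < t < c -> sqrt (sp t) <= s).
  intros t Ht; rewrite Hspg by lra; apply Rlt_le, Hdel.
  unfold ball; simpl; unfold AbsRing_ball, abs, minus, plus, opp; simpl.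
  rewrite Rabs_pos_eq; lra.
specialize (Hup Hsmall).
replace (K * (m * (s * c) / (1 + M))) with (s * c * A) in Hlow by (unfold A; field; lra).
replace (c * (2 * s * (M * s / bp) + (M * s / bp) ^ 2)) with (s * c * (s * B)) in Hup
  by (unfold B; field; lra).
assert (Hle : A <= s * B); [|lra].
apply Rmult_le_reg_l with (s * c); [now apply Rmult_lt_0_compat|lra].
Qed.

(** * Vanishing of the first variation *)

(** The running integral of h^2 is nondecreasing, starts at 0 and ends at most at 0, so it vanishes
    identically, and so does its derivative h^2. *)
Lemma RInt_sqr_zero (h : R -> R) (c : R) : 0 < c -> (forall t, continuous h t) ->
  RInt (fun t => h t * h t) 0 c <= 0 -> forall t, 0 <= t < c -> h t = 0.
Proof.
intros Hc Hh Hint.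
assert (Hhh : forall t, continuous (fun t => h t * h t) t).
  intros t; assert (Ht := Hh t); cont.
assert (Hmono : forall a b, a <= b ->
    RInt (fun t => h t * h t) 0 a <= RInt (fun t => h t * h t) 0 b).
  intros a b Hab.
  rewrite <- (RInt_Chasles _ 0 a b) by (apply ex_RInt_continuous_everywhere, Hhh).
  assert (0 <= RInt (fun t => h t * h t) a b).
    apply RInt_ge_0; [exact Hab|apply ex_RInt_continuous_everywhere, Hhh|].
    intros t _; apply Rle_0_sqr.
  unfold plus; simpl; lra.
assert (Hzero : forall t, 0 <= t <= c -> RInt (fun t => h t * h t) 0 t = 0).
  intros t Ht; apply Rle_antisym.
    apply Rle_trans with (2 := Hint), Hmono; lra.
  apply Rle_trans with (RInt (fun t => h t * h t) 0 0); [|apply Hmono; lra].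
  rewrite RInt_point; apply Rle_refl.
assert (Hin : forall t, 0 < t < c -> h t = 0).
  intros t Ht.
  assert (Hd := is_derive_RInt_continuous (fun t => h t * h t) 0 t Hhh).
  apply (is_derive_ext_loc _ (fun _ => 0)) in Hd.
    apply is_derive_unique in Hd; rewrite Derive_const in Hd; apply Rsqr_0_uniq.
    unfold Rsqr; now rewrite Hd.
  generalize (locally_between 0 c t Ht); apply filter_imp.
  intros s Hs; apply Hzero; lra.
intros t [[Ht0|<-] Htc]; [apply Hin; lra|].
apply (filterlim_locally_unique (F := at_right 0) (V := R_NormedModule) h).
  intros P HP; apply filter_le_within, (Hh 0), HP.
apply filterlim_ext_loc with (fun _ => 0); [|apply filterlim_const].
exists (mkposreal c Hc); intros s Hs Hs0; symmetry; apply Hin.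
apply Rabs_def2 in Hs; unfold minus, plus, opp in Hs; simpl in Hs; lra.
Qed.

Section Stationarity.

Variables (c : R) (g : R -> R).
Hypotheses (Hc : 0 < c < c0) (Hg : forall t, continuous g t).
Hypothesis Hspg : forall t, 0 <= t <= c -> sp t = g t.
Variable u0 : R.
Hypotheses (Hu0 : 0 < u0) (Hgu : forall t, 0 <= t <= c -> u0 <= sqrt (g t)).

Definition alpha t := exp (- theta * t) * (gamma * theta * (1 - f t) * growth t).
Definition beta t := exp (- theta * t) * (2 * sqrt (g t) * growth t / bp).
(** Integrating alpha y by parts with y(0) = y(c) = 0 turns the first variation into minus the
    integral of this function times y'. *)
Definition multiplier t := beta t + RInt alpha 0 t.
Definition multiplier_mean := RInt multiplier 0 c / c.
(** The test direction y'. Subtracting from the mean makes its integral over [0, c] vanish, so y(c)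
    = 0; the sign makes the first variation a square. *)
Definition deviation t := multiplier_mean - multiplier t.

Lemma alpha_continuous t : continuous alpha t.
Proof. unfold alpha; cont; [apply Hfc|now apply growth_continuous]. Qed.

Lemma beta_continuous t : continuous beta t.
Proof. unfold beta; cont; [apply Hg|now apply growth_continuous|lra]. Qed.

Lemma multiplier_continuous t : continuous multiplier t.
Proof.
unfold multiplier; cont; [apply beta_continuous|].
apply is_derive_continuous with (alpha t).
apply is_derive_RInt_continuous, alpha_continuous.
Qed.

Lemma deviation_continuous t : continuous deviation t.
Proof. unfold deviation; cont; apply multiplier_continuous. Qed.

Lemma RInt_deviation_continuous t : continuous (RInt deviation 0) t.
Proof.
apply is_derive_continuous with (deviation t).
apply is_derive_RInt_continuous, deviation_continuous.
Qed.

Lemma RInt_deviation_end : RInt deviation 0 c = 0.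
Proof.
unfold deviation.
rewrite (RInt_minus (V := R_CompleteNormedModule) (fun _ => multiplier_mean) multiplier).
  rewrite RInt_const; unfold minus, plus, opp, scal; simpl; unfold mult; simpl.
  unfold multiplier_mean; field; lra.
  apply ex_RInt_const.
apply ex_RInt_continuous_everywhere, multiplier_continuous.
Qed.

Definition first_variation t :=
  alpha t * RInt deviation 0 t - beta t * deviation t.

(** The terms of second order in eps carry the factors 1/W and 1/W^2 with the damping W; for W >=
    1/2 these are at most 2 and 4. *)
Definition second_variation_bound t :=
  2 * Rabs (first_variation t * (growth t * RInt deviation 0 t)) +
  4 * (exp (- theta * t) * (growth t * deviation t / bp) ^ 2).

Lemma first_variation_continuous t : continuous first_variation t.
Proof.
unfold first_variation; cont;
  [apply alpha_continuous|apply RInt_deviation_continuous|apply beta_continuous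
  |apply deviation_continuous].
Qed.

Lemma second_variation_bound_continuous t : continuous second_variation_bound t.
Proof.
unfold second_variation_bound; cont.
  apply (continuous_comp (fun t => first_variation t * (growth t * RInt deviation 0 t)) Rabs).
    cont; [apply first_variation_continuous|now apply growth_continuous
      |apply RInt_deviation_continuous].
  apply continuous_Rabs.
assert (H : continuous (fun t => growth t * deviation t / bp) t).
  cont; [now apply growth_continuous|apply deviation_continuous|lra].
simpl; apply (continuous_Rmult (fun t => growth t * deviation t / bp)); [exact H|].
apply (continuous_Rmult (fun t => growth t * deviation t / bp)); [exact H|].
apply continuous_const.
Qed.

Lemma first_variation_integral :
  is_RInt first_variation 0 c (RInt (fun t => deviation t * deviation t) 0 c).
Proof.
assert (Hdd : forall t, continuous (fun t => deviation t * deviation t) t).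
  intros t; cont; apply deviation_continuous.
(* An explicit primitive of the first variation, found by integrating by parts. Its first two terms
   vanish at 0 and at [c], where y does. *)
set (Q t := RInt alpha 0 t * RInt deviation 0 t - multiplier_mean * RInt deviation 0 t +
  RInt (fun t => deviation t * deviation t) 0 t).
replace (RInt (fun t => deviation t * deviation t) 0 c) with (Q c - Q 0).
  apply (is_RInt_derive Q); intros t _; [|apply first_variation_continuous].
  assert (H1 := is_derive_RInt_continuous alpha 0 t alpha_continuous).
  assert (H2 := is_derive_RInt_continuous deviation 0 t deviation_continuous).
  assert (H3 := is_derive_RInt_continuous _ 0 t Hdd).
  unfold Q; der; unfold first_variation.
  replace (beta t) with (multiplier_mean - deviation t - RInt alpha 0 t)
    by (unfold deviation, multiplier; ring).
  simpl; ring.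
unfold Q; rewrite RInt_deviation_end, !RInt_point; unfold zero; simpl; ring.
Qed.

(** The perturbation y' = eps times the deviation gains at least eps V - eps^2 N, where V and N are
    the two integrals. Optimality makes this at most 0, and eps is divided out. The two smallness
    conditions ensure W >= 1/2 and a bump of size at most u0 <= sqrt(s_p). *)
Lemma deviation_variation eps : 0 < eps ->
  (forall t, 0 <= t <= c -> eps * Rabs (growth t * RInt deviation 0 t) <= / 2) ->
  (forall t, 0 <= t <= c -> 2 * (eps * Rabs (growth t * deviation t / bp)) <= u0) ->
  RInt (fun t => deviation t * deviation t) 0 c <= eps * RInt second_variation_bound 0 c.
Proof.
intros Heps H1 H2.
set (yd t := eps * deviation t).
assert (Hyd : forall t, continuous yd t).
  intros t; unfold yd; cont; apply deviation_continuous.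
assert (Hint : forall t, RInt yd 0 t = eps * RInt deviation 0 t).
  intros t; apply (RInt_scal (V := R_CompleteNormedModule)).
  apply ex_RInt_continuous_everywhere, deviation_continuous.
assert (Hwin : forall t, 0 <= t <= c -> window c yd t = eps * RInt deviation 0 t).
  intros t Ht; unfold window; rewrite Rmin_left by lra; apply Hint.
assert (Hd : forall t, 0 <= t <= c ->
    damping c yd t = 1 + eps * (growth t * RInt deviation 0 t)).
  intros t Ht; unfold damping; rewrite Hwin by exact Ht; ring.
assert (Hdhalf : forall t, 0 <= t <= c -> / 2 <= damping c yd t).
  intros t Ht; rewrite Hd by exact Ht.
  assert (Ha := H1 t Ht); rewrite <- (Rabs_pos_eq eps) in Ha at 1 by lra.
  rewrite <- Rabs_mult in Ha; apply Rabs_le_between in Ha; lra.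
assert (Hdpos : forall t, 0 <= t <= c -> 0 < damping c yd t).
  intros t Ht; generalize (Hdhalf t Ht); lra.
assert (Hend : 0 <= RInt yd 0 c) by (rewrite Hint, RInt_deviation_end; lra).
assert (Hinv : forall t, 0 <= t <= c -> 0 < / damping c yd t <= 2).
  intros t Ht; split; [now apply Rinv_0_lt_compat, Hdpos|].
  rewrite <- (Rinv_inv 2); apply Rinv_le_contravar; [lra|now apply Hdhalf].
assert (Hb : forall t, 0 <= t <= c ->
    bump c yd t = eps * (growth t * deviation t / bp) * / damping c yd t).
  intros t Ht; assert (Hdt := Hdpos t Ht); unfold bump, yd at 1; field; lra.
assert (Hbump : forall t, 0 <= t <= c -> 0 <= sqrt (sp t) + bump c yd t).
  intros t Ht; rewrite Hspg, Hb by lra.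
  assert (Hub := Hgu t Ht); assert (Hbt := H2 t Ht); assert (Hit := Hinv t Ht).
  assert (Habs : Rabs (eps * (growth t * deviation t / bp) * / damping c yd t) <= u0).
    rewrite !Rabs_mult, (Rabs_pos_eq eps), (Rabs_pos_eq (/ _)) by lra.
    apply Rle_trans with (2 := Hbt); rewrite Rmult_comm.
    apply Rmult_le_compat_r; [|lra].
    apply Rmult_le_pos; [lra|apply Rabs_pos].
  apply Rabs_le_between in Habs; lra.
assert (Hvar := variation c yd Hc Hyd Hdpos Hend Hbump c (Rle_refl c)
  (le_horizon c Hc c (Rle_refl c))).
assert (Hlow : is_RInt (fun t => eps * first_variation t -
    eps * eps * second_variation_bound t) 0 c
    (eps * RInt (fun t => deviation t * deviation t) 0 c -
     eps * eps * RInt second_variation_bound 0 c)).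
  apply (is_RInt_minus (V := R_NormedModule)); apply (is_RInt_scal (V := R_NormedModule)).
    exact first_variation_integral.
  apply (RInt_correct (V := R_CompleteNormedModule)).
  apply ex_RInt_continuous_everywhere, second_variation_bound_continuous.
assert (Hup : is_RInt (fun t => gamma * theta * (exp (- theta * t) * gap c yd t) -
    exp (- theta * t) * (sp_pert c yd t - sp t)) 0 c
    (gamma * theta * gap_int c yd c - extra_cost c yd)).
  apply (is_RInt_minus (V := R_NormedModule)).
    apply (is_RInt_scal (V := R_NormedModule)).
    apply (RInt_correct (V := R_CompleteNormedModule)), ex_RInt_gap; auto; lra.
  now apply extra_cost_correct.
assert (Hle := is_RInt_le _ _ 0 c _ _ ltac:(lra) Hlow Hup).
assert (Hpt : forall t, 0 < t < c ->
    eps * first_variation t - eps * eps * second_variation_bound t <=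
    gamma * theta * (exp (- theta * t) * gap c yd t) -
    exp (- theta * t) * (sp_pert c yd t - sp t)).
  intros t Ht.
  assert (Ht' : 0 <= t <= c) by lra.
  rewrite (gap_eq c yd Hdpos Hend t ltac:(lra)), Hwin by exact Ht'.
  unfold sp_pert; destruct Rlt_dec as [_|]; [|lra].
  rewrite Hb, Hspg by exact Ht'.
  assert (Hsq0t : 0 <= g t).
    rewrite <- Hspg by exact Ht'; apply Hsp; split; [lra|apply le_horizon with c; auto; lra].
  rewrite <- (sqrt_sqrt (g t)) at 2 by exact Hsq0t.
  assert (Hit := Hinv t Ht'); assert (Hdt := Hd t Ht'); assert (Hdp := Hdpos t Ht').
  (* W = 1 + eps x, so that 1 / W = 1 - eps x / W isolates the first-order term. *)
  set (W := damping c yd t) in *; set (x := growth t * RInt deviation 0 t) in *.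
  set (z := exp (- theta * t) * (growth t * deviation t / bp) ^ 2).
  assert (Hz : 0 <= z) by (apply Rmult_le_pos; [apply Rlt_le, exp_pos|apply pow2_ge_0]).
  match goal with |- _ <= ?rhs => replace rhs with
    (eps * first_variation t -
     eps * eps * (first_variation t * x * / W + z * (/ W * / W))) end.
    apply Rplus_le_compat_l, Ropp_le_contravar, Rmult_le_compat_l;
      [apply Rmult_le_pos; lra|].
    unfold second_variation_bound; fold x z; apply Rplus_le_compat.
      apply Rle_trans with (1 := Rle_abs _).
      rewrite Rabs_mult, (Rabs_pos_eq (/ W)), Rmult_comm by lra.
      apply Rmult_le_compat_r; [apply Rabs_pos|lra].
    rewrite Rmult_comm; apply Rmult_le_compat_r; [exact Hz|].
    replace 4 with (2 * 2) by ring; apply Rmult_le_compat; lra.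
  transitivity (eps * first_variation t * / W - eps * eps * z * (/ W * / W)).
    replace (eps * first_variation t * / W) with
      (eps * first_variation t * (W - eps * x) * / W) by (rewrite Hdt; ring).
    field; lra.
  unfold first_variation, alpha, beta, z; field; lra.
specialize (Hle Hpt).
apply Rmult_le_reg_l with eps; [exact Heps|].
rewrite <- Rmult_assoc; lra.
Qed.

Lemma deviation_zero t : 0 <= t < c -> deviation t = 0.
Proof.
apply RInt_sqr_zero; [lra|exact deviation_continuous|].
destruct (continuous_bounded (fun t => growth t * RInt deviation 0 t) 0 c)
  as [M1 [HM1 H1]]; [lra| |].
  intros s; cont; [now apply growth_continuous|apply RInt_deviation_continuous].
destruct (continuous_bounded (fun t => growth t * deviation t / bp) 0 c)
  as [M2 [HM2 H2]]; [lra| |].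
  intros s; cont; [now apply growth_continuous|apply deviation_continuous|lra].
set (V := RInt (fun t => deviation t * deviation t) 0 c).
set (N := RInt second_variation_bound 0 c).
apply Rnot_lt_le; intros HV.
assert (HN : 0 < Rmax 1 N) by (apply Rlt_le_trans with (2 := Rmax_l 1 N); lra).
(* The three bounds give W >= 1/2, a nonnegative perturbed root, and eps N <= V/2, which contradicts
   V <= eps N for V > 0. *)
set (eps := Rmin (/ (2 * M1)) (Rmin (u0 / (2 * M2)) (V / (2 * Rmax 1 N)))).
assert (He1 : eps <= / (2 * M1)) by apply Rmin_l.
assert (He2 : eps <= u0 / (2 * M2)).
  apply Rle_trans with (1 := Rmin_r _ _), Rmin_l.
assert (He3 : eps <= V / (2 * Rmax 1 N)).
  apply Rle_trans with (1 := Rmin_r _ _), Rmin_r.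
assert (Heps : 0 < eps).
  repeat apply Rmin_glb_lt;
    [apply Rinv_0_lt_compat; lra|apply Rdiv_lt_0_compat; lra|apply Rdiv_lt_0_compat; lra].
assert (Hbound : forall e M B z, 0 < M -> 0 < e -> e <= B / M -> Rabs z <= M ->
    e * Rabs z <= B).
  intros e M B z HM He HeB Hz.
  replace B with (B / M * M) by (field; lra).
  apply Rmult_le_compat; [lra|apply Rabs_pos|exact HeB|exact Hz].
assert (Hle := deviation_variation eps Heps).
fold V N in Hle; enough (V <= eps * N).
  assert (eps * N <= V / 2); [|lra].
  replace (V / 2) with (V / (2 * Rmax 1 N) * Rmax 1 N) by (field; lra).
  apply Rle_trans with (eps * Rmax 1 N).
    apply Rmult_le_compat_l; [lra|apply Rmax_r].
  apply Rmult_le_compat_r; lra.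
apply Hle; intros s Hs.
  apply Hbound with M1; auto.
  replace (/ 2 / M1) with (/ (2 * M1)) by (field; lra); exact He1.
assert (Hb : eps * Rabs (growth s * deviation s / bp) <= u0 / 2); [|lra].
apply Hbound with M2; auto.
replace (u0 / 2 / M2) with (u0 / (2 * M2)) by (field; lra); exact He2.
Qed.

End Stationarity.

(** * The right derivative at time 0 *)

Lemma is_right_derive_of_is_derive (s S : R -> R) (c l : R) : 0 < c ->
  (forall t, 0 <= t < c -> s t = S t) -> is_derive S 0 l -> is_right_derive s 0 l.
Proof.
intros Hc Hs HS; apply is_derive_Reals in HS.
apply filterlim_locally; intros eps.
destruct (HS eps (cond_pos eps)) as [del Hdel].
assert (Hm : 0 < Rmin del c) by (apply Rmin_glb_lt; [apply cond_pos|exact Hc]).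
exists (mkposreal _ Hm); intros t Ht Ht0.
apply Rabs_def2 in Ht; unfold minus, plus, opp in Ht; simpl in Ht.
assert (H1 := Rmin_l del c); assert (H2 := Rmin_r del c).
rewrite !Hs by lra; specialize (Hdel t).
rewrite Rplus_0_l in Hdel; rewrite Rminus_0_r; apply Hdel; [lra|].
rewrite Rabs_pos_eq; lra.
Qed.

Lemma sp_right_derive : theta < q0 -> exists l : R, is_right_derive sp 0 l /\ l < 0.
Proof.
intros hq0theta; assert (Hpos := sp_0_pos).
assert (Hc0 : 0 < c0) by apply Hsp0.
destruct (piece_extension sp 0 c0 Hsp0) as [g [Hg Hspg]].
destruct (piece_extension sq 0 c0 Hsq0) as [gq [Hgq Hsqg]].
(* Half the initial root is a lower bound for sqrt(s_p) near 0, which leaves room for perturbations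
   of both signs. *)
set (u0 := sqrt (sp 0) / 2).
assert (Hs0 : 0 < sqrt (sp 0)) by now apply sqrt_lt_R0.
assert (Hu0 : 0 < u0) by (unfold u0; lra).
assert (Hloc : locally 0 (fun t => u0 < sqrt (g t))).
  assert (Hcg : continuous (fun t => sqrt (g t)) 0) by (cont; apply Hg).
  apply (Hcg (fun y => u0 < y)), open_gt.
  rewrite <- Hspg by lra; unfold u0; lra.
destruct Hloc as [del Hdel].
assert (Hex : exists c, 0 < c < c0 /\ c < del).
  exists (Rmin (c0 / 2) (del / 2)).
  assert (Hd := cond_pos del).
  assert (H3 := Rmin_l (c0 / 2) (del / 2)); assert (H4 := Rmin_r (c0 / 2) (del / 2)).
  assert (0 < Rmin (c0 / 2) (del / 2)) by (apply Rmin_glb_lt; lra); lra.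
destruct Hex as [c [Hc Hcd]].
assert (Hdev := deviation_zero c g Hc Hg ltac:(intros t Ht; apply Hspg; lra) u0 Hu0).
set (m := multiplier_mean c g) in Hdev.
assert (Hbeta : forall t, 0 <= t < c -> beta g t = m - RInt alpha 0 t).
  intros t Ht.
  assert (Hdt : deviation c g t = 0).
    apply Hdev; [|exact Ht]; intros s Hs; apply Rlt_le, Hdel.
    unfold ball; simpl; unfold AbsRing_ball, abs, minus, plus, opp; simpl.
    rewrite Rabs_pos_eq; lra.
  unfold deviation, multiplier in Hdt; fold m in Hdt; lra.
(* [rate] with the continuous extension of s_q: its integral is differentiable at 0 from both sides
   and agrees with that of [rate] on [0, c). *)
set (r t := (q0 + bq * sqrt (gq t)) * (1 - f t)).
assert (Hr : forall t, continuous r t).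
  intros t; unfold r; cont; [apply Hgq|apply Hfc].
assert (Hgrowth : forall t, 0 <= t < c -> growth t = exp (RInt r 0 t)).
  intros t Ht; unfold growth; f_equal.
  rewrite clampT_id by (split; [lra|apply le_horizon with c; auto; lra]).
  apply RInt_ext; rewrite Rmin_left, Rmax_right by lra; intros s Hs.
  unfold rate, r; rewrite Hsqg by lra; reflexivity.
(* Constancy of the multiplier, beta = m - int alpha, solved for sqrt(s_p). The right-hand side is
   differentiable at 0. *)
set (S t := (m - RInt alpha 0 t) * bp / (2 * exp (- theta * t) * exp (RInt r 0 t))).
assert (HS : forall t, 0 <= t < c -> sqrt (sp t) = S t).
  intros t Ht; unfold S; rewrite <- Hbeta, <- Hgrowth by exact Ht.
  unfold beta; rewrite Hspg by lra.
  assert (H1 := exp_pos (- theta * t)); assert (H2 := growth_ge_1 t).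
  field; lra.
assert (Hf0 : f 0 = 0) by apply Hf.
assert (HS0 : S 0 = m * bp / 2).
  unfold S; rewrite !RInt_point, Rmult_0_r, exp_0; unfold zero; simpl.
  rewrite exp_0; field.
assert (Hm : 0 < m * bp) by (rewrite HS, HS0 in Hs0 by lra; lra).
assert (Ha0 : alpha 0 = gamma * theta).
  unfold alpha; rewrite Hf0, Hgrowth, RInt_point by lra; unfold zero; simpl.
  rewrite Rmult_0_r, exp_0; ring.
assert (Hr0 : q0 <= r 0).
  unfold r; rewrite Hf0, Rminus_0_r, Rmult_1_r; apply (q_ge_q0 (gq 0)).
(* As u(0) = m b_p / 2 and r(0) = q(s_q(0)), this derivative is u(0) (theta - q(s_q(0))) - gamma
   theta b_p / 2. *)
assert (HSd : is_derive S 0 ((- (gamma * theta) + m * theta - m * r 0) * bp / 2)).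
  assert (H1 := is_derive_RInt_continuous alpha 0 0 alpha_continuous).
  assert (H2 := is_derive_RInt_continuous r 0 0 Hr).
  unfold S; der.
    apply Rgt_not_eq; repeat apply Rmult_lt_0_compat; try apply exp_pos; lra.
  rewrite Ha0, !RInt_point; unfold zero; simpl.
  replace (- theta * 0) with 0 by ring; rewrite exp_0; field.
exists (2 * S 0 * ((- (gamma * theta) + m * theta - m * r 0) * bp / 2)); split.
  apply (is_right_derive_of_is_derive sp (fun t => S t * S t) c); [lra| |].
    intros t Ht; rewrite <- HS by exact Ht; symmetry; apply sqrt_sqrt.
    apply Hsp; split; [lra|apply le_horizon with c; auto; lra].
  der; ring.
rewrite HS0.
(* Strictness comes from r(0) >= q0 > theta and m b_p > 0; the term with gamma theta may vanish, as
   theta = 0 is allowed. *)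
assert (Hlt : (- (gamma * theta) + m * theta - m * r 0) * bp < 0).
  assert (H1 : 0 <= gamma * theta * bp) by (repeat apply Rmult_le_pos; lra).
  assert (H2 : 0 < m * bp * (r 0 - theta)) by (apply Rmult_lt_0_compat; lra).
  lra.
generalize (Rmult_lt_0_compat (m * bp) _ Hm (Ropp_0_gt_lt_contravar _ Hlt)); lra.
Qed.

End Optimum.

(** * A common first piece, and the conclusion *)

Lemma first_piece T s1 s2 : Rbar_lt 0 T ->
  piecewise_continuous T s1 -> piecewise_continuous T s2 ->
  exists c : R, Rbar_le c T /\ piece s1 0 c /\ piece s2 0 c.
Proof.
intros hT H1 H2.
assert (HX : exists X : R, 0 < X /\ Rbar_le X T).
  destruct T as [x| |]; [exists x|exists 1|easy]; split; simpl in *; auto; lra.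
destruct HX as [X [HX HXT]].
assert (Hfirst : forall s, piecewise_continuous T s ->
    exists c, 0 < c <= X /\ piece s 0 c).
  intros s Hs.
  assert (Hp := proj1 (piecewise_continuous_pieces T s) Hs X HX HXT).
  inversion Hp as [a Ha|a m Ham Hm]; subst; [exists X; split; [lra|exact Ha]|].
  exists m; split; [|exact Ham].
  apply pieces_lt in Hm; destruct Ham as [Ham _]; lra.
destruct (Hfirst s1 H1) as [c1 [Hc1 Hp1]]; destruct (Hfirst s2 H2) as [c2 [Hc2 Hp2]].
assert (Hshrink : forall s a b, 0 < a <= b -> piece s 0 b -> piece s 0 a).
  intros s a b [Ha [Hab| ->]] Hp; [|exact Hp].
  apply (piece_split s 0 a b); [lra|exact Hp].
assert (Hmin : 0 < Rmin c1 c2) by (apply Rmin_glb_lt; lra).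
exists (Rmin c1 c2); split; [|split].
- apply Rbar_le_trans with X; [simpl|exact HXT].
  apply Rle_trans with c1; [apply Rmin_l|lra].
- apply Hshrink with c1; [split; [lra|apply Rmin_l]|exact Hp1].
- apply Hshrink with c2; [split; [lra|apply Rmin_r]|exact Hp2].
Qed.

Theorem corollary4 (p0 q0 bp bq gamma theta : R) (T : Rbar) (sp sq : R -> R)
  (hp0 : 0 < p0) (hq0 : 0 < q0) (hbp : 0 < bp) (hbq : 0 < bq)
  (hgamma : 0 < gamma) (htheta : 0 <= theta)
  (hT : Rbar_lt 0 T) (hTtheta : T = p_infty -> 0 < theta)
  (hopt : optimal_promotion (fun x : R => p0 + bp * sqrt x)
            (fun x : R => q0 + bq * sqrt x) gamma theta T sp sq)
  (hq0theta : theta < q0) :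
  0 < sp 0 /\ exists l : R, is_right_derive sp 0 l /\ l < 0.
Proof.
destruct hopt as [Hsp [Hsq [f [v [Hf [Hv Hmax]]]]]].
destruct (first_piece T sp sq hT (proj1 Hsp) (proj1 Hsq)) as [c0 [Hc0T [Hsp0 Hsq0]]].
(* The perturbation argument takes [f] continuous on all of R, so the clamped adoption level, with
   the same profit, replaces the given one. *)
assert (Hf' := adoption_level_clamp _ _ T sp sq f hT Hf).
assert (Hfc := fun t => continuous_on_clampT T f t hT (proj1 Hf)).
assert (Hv' := is_profit_clamp gamma theta T sp sq f v hT Hv).
set (f' t := f (clampT T t)) in *.
split; [eapply (sp_0_pos p0 q0 bp bq gamma theta T sp sq f')
  |eapply (sp_right_derive p0 q0 bp bq gamma theta T sp sq f')]; eassumption.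
Qed.
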